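(* Let $\mathbb{X}$ be an $n$-dimensional (real or complex) Banach space. The bifurcation points of $|\det|\colon S^n_{\mathbb{X},\neq 0}\to\mathbb{R}$ correspond to the Auerbach bases of $\mathbb{X}$. Furthermore, two distinct bifurcation points of the induced map on $S^n_{\mathbb{X},\neq 0}/\mathrm{B}_n$ (on $S^n_{\mathbb{X},\neq 0}/N(T_n)$ in the complex case) correspond to two distinct equivalence classes of Auerbach bases.
   Context: $S_{\mathbb{X}}$ is the unit sphere of $\mathbb{X}$. Viewing elements of the $n$-fold product $S_{\mathbb{X}}^n$ as matrices whose rows are unit vectors, so that $\det$ is defined on it, put $S^n_{\mathbb{X},\neq 0}=\{(v_1,\dots,v_n)\in S_{\mathbb{X}}^n \mid \det(v_1,\dots,v_n)\neq 0\}$. A basis $\{v_1,\dots,v_n\}$ of $\mathbb{X}$ is an Auerbach basis if $v_i\in S_{\mathbb{X}}$ for all $i$ and there is a basis $\{v^1,\dots,v^n\}$ of the dual space $\mathbb{X}^*$ with $v^i(v_j)=\delta_{ij}$ and $v^i\in S_{\mathbb{X}^*}$ for all $i,j$. In the real case, $\mathrm{B}_n\subset O(n)$ is the group generated by the permutation matrices and the diagonal matrices with entries $\pm 1$; in the complex case, $N(T_n)=N_{U(n)}(T_n)$ is the normalizer in $U(n)$ of the torus $T_n$ of diagonal unitary matrices. These groups act on $S^n_{\mathbb{X},\neq 0}$ by permuting the vectors and multiplying them by scalars of absolute value one, and $|\det|$ descends to a well-defined map on the quotient; two bases are equivalent if they lie in the same orbit. For a topological manifold $M$ and a continuous function $g\colon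 M\to\mathbb{R}$, a point $x\in M$ is a topologically regular point of $g$ if there exist a neighborhood $U$ of $x$ and a homeomorphism $h\colon S\times(a-\epsilon,a+\epsilon)\to U$, for some space $S$, such that $g\circ h$ is the projection onto the second factor; if $x$ is not topologically regular, it is called a bifurcation point of $g$.
   Formalization: ''Correspond'' is read one way: every bifurcation point is an Auerbach basis, and distinct bifurcation points of the quotient give distinct classes; the converse is omitted because an Auerbach basis can be a topologically regular point of |det| (already for some real planes). *)

(* Defs.v *)
From HB Require Import structures.
From mathcomp Require Import all_boot all_order all_algebra fingroup perm.
From mathcomp Require Import generic_quotient spectral.
From mathcomp Require Import all_classical all_reals all_analysis.
From mathcomp Require Import complex.

Set Implicit Arguments.
Unset Strict Implicit.
Unset Printing Implicit Defensive.

Import Order.TTheory GRing.Theory Num.Theory.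
Import numFieldNormedType.Exports.
Local Open Scope classical_set_scope.
Local Open Scope ring_scope.
Local Open Scope quotient_scope.
Local Open Scope complex_scope.

Definition homeomorphism (X Y : topologicalType) (h : X -> Y) : Prop :=
  continuous h /\
  exists k : Y -> X, [/\ continuous k, cancel h k & cancel k h].

(* [U] and the open interval are used as types, with the topology that
   [set_type] inherits from the ambient space. *)
Definition topologically_regular (R : realType) (M : topologicalType)
    (g : M -> R) (x : M) : Prop :=
  exists (U : set M) (S : topologicalType) (a e : R)
         (h : S * (`](a - e), (a + e)[%classic : set R) -> U),
    [/\ nbhs x U, 0 < e, homeomorphism h &
        forall p, g (\val (h p)) = \val p.2].

Definition bifurcation_point (R : realType) (M : topologicalType)
    (g : M -> R) (x : M) : Prop := ~ topologically_regular g x.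

Definition is_basis (K : fieldType) (V : lmodType K) (W : set V) (n : nat)
    (v : 'I_n -> V) : Prop :=
  (forall i, W (v i)) /\
  (forall x, W x -> exists! c : 'rV[K]_n, x = \sum_(i < n) c 0 i *: v i).

Section AuerbachBases.
Variables (K : numFieldType) (X : normedModType K).

Definition dual_space : set (X -> K^o) := [set f | linear f /\ continuous f].

(* The operator norm of [f] equals 1.  It is stated with [supremums] rather
   than [sup] so as to make sense for complex scalars too, whose norms are
   elements of [R[i]]. *)
Definition dual_sphere : set (X -> K^o) :=
  [set f | dual_space f /\
           supremums [set `|f x| | x in [set x : X | `|x| <= 1]] (1 : K)].

Definition auerbach (n : nat) (v : 'I_n -> X) : Prop :=
  [/\ is_basis [set: X] v,
      forall i, `|v i| = 1 &
      exists f : 'I_n -> X -> K^o,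
        [/\ is_basis dual_space f,
            forall i j, f i (v j) = (i == j)%:R &
            forall i, dual_sphere (f i)]].

End AuerbachBases.

Section Frames.
Variables (K : numFieldType) (X : normedModType K) (n : nat).
(* [phi] is meant to be bijective: a choice of coordinates on [X] *)
Variable phi : {linear X -> 'rV[K]_n}.

Definition rows (v : 'I_n -> X) : 'M[K]_n := \matrix_(i < n) phi (v i).

(* $S^n_{X, \neq 0}$, as a subspace of the product space $X^n$ *)
Definition frames : set {ptws 'I_n -> X} :=
  [set v | (forall i, `|v i| = 1) /\ \det (rows v) != 0].

Definition det_frame (v : frames) : K := \det (rows (\val v)).

End Frames.

(* The modulus with values in [R]; [`|z|] is an element of [R[i]]. *)
Definition modulus (R : realType) (z : R[i]) : R := complex.Re `|z|.

Definition absdetR (R : realType) (X : normedModType R) (n : nat)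
    (phi : {linear X -> 'rV[R]_n}) (v : frames phi) : R := `|det_frame v|.

Definition absdetC (R : realType) (X : normedModType R[i]) (n : nat)
    (phi : {linear X -> 'rV[R[i]]_n}) (v : frames phi) : R :=
  modulus (det_frame v).
Arguments absdetR {R X n} phi v.
Arguments absdetC {R X n} phi v.

Definition is_matrix_group (K : fieldType) (n : nat) (G : set 'M[K]_n) : Prop :=
  [/\ forall g, G g -> g \in unitmx,
      G 1%:M,
      forall g h, G g -> G h -> G (g *m h) &
      forall g, G g -> G (invmx g)].

Definition Bn (n : nat) (R : realType) : set 'M[R]_n :=
  smallest (@is_matrix_group R n)
    ([set perm_mx s | s in [set: 'S_n]] `|`
     [set diag_mx d | d in [set d : 'rV[R]_n | forall i, d 0 i = 1 \/ d 0 i = -1]]).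
Arguments Bn n R : clear implicits.

Definition Tn (n : nat) (R : realType) : set 'M[R[i]]_n :=
  [set diag_mx d | d in [set d : 'rV[R[i]]_n | forall i, `|d 0 i| = 1]].
Arguments Tn n R : clear implicits.

Definition NTn (n : nat) (R : realType) : set 'M[R[i]]_n :=
  [set g | g \is unitarymx /\
           [set g *m t *m invmx g | t in Tn n R] = Tn n R].
Arguments NTn n R : clear implicits.

Lemma Bn_group (n : nat) (R : realType) : is_matrix_group (Bn n R).
Proof.
split=> [g Bg|G [[_ G1 _ _] _] //|g h Bg Bh G GG|g Bg G GG].
- apply: (Bg [set g | g \in unitmx]); split=> /=.
    split=> //; first exact: unitmx1.
      by move=> a b /= ua ub; rewrite unitmx_mul ua.
    by move=> a /= ua; rewrite unitmx_inv.
  move=> _ [[s _ <-]|[d /= dP <-]] /=; first exact: unitmx_perm.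
  rewrite unitmxE det_diag rpred_prod// => i _.
  by case: (dP i) => ->; rewrite ?unitrN unitr1.
- by have [[_ _ GM _] _] := GG; apply: GM; [exact: Bg|exact: Bh].
- by have [[_ _ _ GV] _] := GG; apply: GV; exact: Bg.
Qed.

Lemma Bn_det (n : nat) (R : realType) (g : 'M[R]_n) :
  Bn n R g -> `|\det g| = 1.
Proof.
move=> Bg; pose H := [set g : 'M[R]_n | g \in unitmx /\ `|\det g| = 1].
suff [] : H g by [].
apply: (Bg H); split=> /=.
  split=> [? []//||a b [ua da] [ub db]|a [ua da]].
  - by split; [exact: unitmx1|rewrite det1 normr1].
  - by split; rewrite ?unitmx_mul ?ua// det_mulmx normrM da db mulr1.
  - by split; rewrite ?unitmx_inv// det_inv normfV da invr1.
move=> _ [[s _ <-]|[d /= dP <-]] /=.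
  by split; [exact: unitmx_perm|rewrite det_perm normr_sign].
split.
  rewrite unitmxE det_diag rpred_prod// => i _.
  by case: (dP i) => ->; rewrite ?unitrN unitr1.
rewrite det_diag normr_prod big1// => i _.
by case: (dP i) => ->; rewrite ?normrN normr1.
Qed.

Lemma NTn_group (n : nat) (R : realType) : is_matrix_group (NTn n R).
Proof.
have U1 : (1%:M : 'M[R[i]]_n) \is unitarymx.
  by apply/unitarymxP; rewrite trmx1 map_mx1 mulmx1.
split.
- by move=> g [/unitarymx_unit].
- split=> //; apply/seteqP; split=> [_ [t Tt <-]|t Tt].
    by rewrite invmx1 mul1mx mulmx1.
  by exists t => //; rewrite invmx1 mul1mx mulmx1.
- move=> g h [Ug Ng] [Uh Nh].
  have gU := unitarymx_unit Ug; have hU := unitarymx_unit Uh.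
  have E t : g *m h *m t *m invmx (g *m h) = g *m (h *m t *m invmx h) *m invmx g.
    suff -> : invmx (g *m h) = invmx h *m invmx g by rewrite !mulmxA.
    apply: (can_inj (mulKmx (_ : g *m h \in unitmx))); first by rewrite unitmx_mul gU.
    rewrite mulmxV ?unitmx_mul ?gU//.
    by rewrite mulmxA -(mulmxA g) mulmxV// mulmx1 mulmxV.
  split; first exact: mul_unitarymx.
  apply/seteqP; split=> [_ [t Tt <-]|t Tt].
    rewrite E -Ng; exists (h *m t *m invmx h) => //.
    by rewrite -Nh; exists t.
  have : [set g *m t *m invmx g | t in Tn n R] t by rewrite Ng.
  case=> u; rewrite -{1}Nh => -[w Tw <- <-].
  by exists w.
- move=> g [Ug Ng]; have gU := unitarymx_unit Ug.
  split.
    by rewrite (invmx_unitary Ug) trmxC_unitary.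
  have C t : invmx g *m (g *m t *m invmx g) *m g = t.
    by rewrite !mulmxA mulVmx// mul1mx -mulmxA mulVmx// mulmx1.
  rewrite invmxK; apply/seteqP; split=> [_ [t + <-]|t Tt].
    by rewrite -{1}Ng => -[u Tu <-]; rewrite C.
  by exists (g *m t *m invmx g) => //; rewrite -Ng; exists t.
Qed.

Lemma NTn_det (n : nat) (R : realType) (g : 'M[R[i]]_n) :
  NTn n R g -> `|\det g| = 1.
Proof.
move=> [/unitarymxP /(congr1 (fun A => \det A))].
rewrite det_mulmx det1 det_map_mx det_tr -normCK => /eqP.
by rewrite pexpr_eq1// => /eqP.
Qed.

Section Action.
Variables (K : numFieldType) (X : normedModType K) (n : nat).
Variable phi : {linear X -> 'rV[K]_n}.
Variable G : set 'M[K]_n.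

(* [w] is the image of [v] under an element of [G], acting on matrices of rows
   by left multiplication *)
Definition equivalent (v w : 'I_n -> X) : Prop :=
  exists2 g, G g & forall i, w i = \sum_(j < n) g i j *: v j.

Lemma equivalent_rows (v w : 'I_n -> X) (g : 'M[K]_n) :
  (forall i, w i = \sum_(j < n) g i j *: v j) -> rows phi w = g *m rows phi v.
Proof.
move=> wE; apply/row_matrixP => i; rewrite row_mul rowK wE linear_sum/=.
rewrite mulmx_sum_row; apply: eq_bigr => j _.
by rewrite linearZ/= rowK !mxE.
Qed.

Hypothesis G_group : is_matrix_group G.

Definition equivalentb (v w : frames phi) : bool :=
  `[< equivalent (\val v) (\val w) >].

Lemma equivalentb_refl : reflexive equivalentb.
Proof.
move=> v; apply/asboolP; case: G_group => _ G1 _ _; exists 1%:M => // i.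
rewrite (bigD1 i)//= big1 ?addr0 ?mxE ?eqxx ?scale1r// => j ji.
by rewrite mxE eq_sym (negbTE ji) scale0r.
Qed.

Lemma equivalentb_trans : transitive equivalentb.
Proof.
move=> v u w /asboolP[g Gg gE] /asboolP[h Gh hE]; apply/asboolP.
case: G_group => _ _ GM _; exists (h *m g); first exact: GM.
move=> i; rewrite hE; under eq_bigr do rewrite gE scaler_sumr.
rewrite exchange_big/=; apply: eq_bigr => j _.
by rewrite mxE scaler_suml; apply: eq_bigr => k _; rewrite scalerA.
Qed.

Lemma equivalentb_sym : symmetric equivalentb.
Proof.
suff H v w : equivalentb v w -> equivalentb w v.
  by move=> v w; apply/idP/idP; exact: H.
move=> /asboolP[g Gg gE]; apply/asboolP.
case: G_group => Gu _ _ GV; exists (invmx g); first exact: GV.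
move=> i; under eq_bigr do rewrite gE scaler_sumr.
rewrite exchange_big/=.
under eq_bigr => j _.
  under eq_bigr do rewrite scalerA.
  rewrite -scaler_suml.
  rewrite (_ : \sum_i0 _ = (invmx g *m g) i j); last by rewrite mxE.
  rewrite mulVmx ?Gu// mxE; over.
rewrite (bigD1 i)//= eqxx scale1r big1 ?addr0// => j ji.
by rewrite eq_sym (negbTE ji) scale0r.
Qed.

Definition equivalent_rel : equiv_rel (frames phi) :=
  EquivRel equivalentb equivalentb_refl equivalentb_sym equivalentb_trans.

Definition frames_quotient := quotient_topology {eq_quot equivalent_rel}.

HB.instance Definition _ := Topological.on frames_quotient.
HB.instance Definition _ := Quotient.on frames_quotient.

(* [f] is meant to be constant on orbits; see [induced_map_pi] *)
Definition induced_map (T : Type) (f : frames phi -> T) (q : frames_quotient) : T :=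
  f (repr q).

Definition orbit_of (q : frames_quotient) : set (frames phi) :=
  [set v | \pi_frames_quotient v = q].

Definition auerbach_class : set (set (frames phi)) :=
  [set A | exists2 v : frames phi, auerbach (\val v) &
     A = [set w | auerbach (\val w) /\ equivalent (\val v) (\val w)]].

Lemma induced_map_pi (T : Type) (f : frames phi -> T) :
  (forall v w : frames phi, equivalent (\val v) (\val w) -> f v = f w) ->
  forall v, induced_map f (\pi_frames_quotient v) = f v.
Proof.
move=> fE v; apply: fE; apply/asboolP.
by have /eqquotP := reprK (\pi_frames_quotient v).
Qed.

End Action.
Arguments frames_quotient {K X n} phi {G} G_group.
Arguments induced_map {K X n phi G} G_group {T} f q.
Arguments orbit_of {K X n phi G} G_group q.
Arguments auerbach_class {K X n} phi G.

Lemma absdetR_equivalent (R : realType) (X : normedModType R) (n : nat)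
    (phi : {linear X -> 'rV[R]_n}) (v w : frames phi) :
  equivalent (Bn n R) (\val v) (\val w) -> absdetR phi v = absdetR phi w.
Proof.
case=> g Bg /(equivalent_rows phi) E.
by rewrite /absdetR /det_frame E det_mulmx normrM (Bn_det Bg) mul1r.
Qed.

Lemma absdetC_equivalent (R : realType) (X : normedModType R[i]) (n : nat)
    (phi : {linear X -> 'rV[R[i]]_n}) (v w : frames phi) :
  equivalent (NTn n R) (\val v) (\val w) -> absdetC phi v = absdetC phi w.
Proof.
case=> g Bg /(equivalent_rows phi) E.
by rewrite /absdetC /modulus /det_frame E det_mulmx normrM (NTn_det Bg) mul1r.
Qed.

(* Main.v *)
From HB Require Import structures.
Require Import Defs.
From mathcomp Require Import all_boot all_order all_algebra.
From mathcomp Require Import fingroup perm generic_quotient spectral.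
From mathcomp Require Import all_classical all_reals all_analysis.
From mathcomp Require Import complex.
From mathcomp Require Import ring lra.

(* If the unit basis [v] is not an Auerbach basis, its dual basis has a member of norm
   greater than one: some unit vector [w] satisfies |det v[i := w]| > |det v|.  For
   the linear form [l x = det u[i := x]] of a frame [u] near [v], the affine hyperplane
   [l = 1] parametrises the unit vectors up to phase, by [x / l x], and there
   |l x| = 1 / |x / l x|.  Since [w / l w] lies inside the sublevel sets of the norm at
   the levels considered, convexity makes the norm strictly increasing along each ray
   from [w / l w] once such a level is reached; sliding [u i] along these rays gives a
   local flow transverse to the level sets of |det|, which is therefore a projection in
   suitable coordinates.  The flow only depends on the orbit of [u] under permutations
   and phases, so it descends to the quotient.

   Real and complex spaces are treated at once: [real_scalars R K] embeds [R] into the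
   scalar field [K], with a modulus taking values in [R]. *)

Set Implicit Arguments.
Unset Strict Implicit.
Unset Printing Implicit Defensive.

Import Order.TTheory GRing.Theory Num.Theory.
Import numFieldNormedType.Exports.
Local Open Scope classical_set_scope.
Local Open Scope ring_scope.
Local Open Scope complex_scope.

(** * Topological regularity from a local flow *)

Lemma cvg_set_type (T : topologicalType) (A : set T) (U : Type)
    (F : set_system U) (f : U -> A) (a : A) :
  Filter F -> (\val (f x)) @[x --> F] --> \val a -> f @ F --> a.
Proof.
move=> FF fa B; case=> _ [] [V oV <- Va VB].
have /fa : nbhs (\val a) V by apply: open_nbhs_nbhs.
by apply: (@filterS _ F) => x /= Vx; exact: VB.
Qed.

Lemma val_set_type_continuous (T : topologicalType) (A : set T) :
  continuous (\val : A -> T).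
Proof. exact: (@initial_continuous _ _ set_val). Qed.

(* Moving every point of [W] along its [P]-curve to the level [a] trivialises [g] on [W]. *)
Lemma regular_of_flow (R : realType) (M : topologicalType) (g : M -> R)
    (W : set M) (a e : R) (P : M -> R -> M) (x : M) :
  0 < e -> continuous g -> open W ->
  (forall u, W u -> a - e < g u < a + e) ->
  (forall u s, W u -> a - e < s < a + e -> W (P u s) /\ g (P u s) = s) ->
  (forall u, W u -> P u (g u) = u) ->
  (forall u s t, W u -> a - e < s < a + e -> a - e < t < a + e ->
    P (P u s) t = P u t) ->
  (forall u s, W u -> a - e < s < a + e ->
    {for (u, s), continuous (fun p : M * R => P p.1 p.2)}) ->
  W x -> topologically_regular g x.
Proof.
move=> e0 cg oW WI WP P1 PP cP Wx.
pose I : set R := `](a - e), (a + e)[%classic.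
have Iin s : I s <-> a - e < s < a + e by rewrite /I/= in_itv.
have Ia : a - e < a < a + e by rewrite ltrDl e0 ltrBlDr ltrDl e0.
pose S : set M := [set u | W u /\ g u = a].
have hW (p : S * I) : W (P (\val p.1) (\val p.2)).
  case: p => [[u uS] [s sI]] /=.
  have [Wu _] := set_mem uS; have /Iin Is := set_mem sI.
  by have [] := WP _ _ Wu Is.
have kS (u : W) : S (P (\val u) a) by apply: WP => //; apply: set_mem (valP u).
have kI (u : W) : I (g (\val u)).
  by apply/Iin/WI; apply: set_mem (valP u).
pose h (p : S * I) : W := @exist M (fun u => u \in W) _ (mem_set (hW p)).
pose k1 (u : W) : S := @exist M (fun u => u \in S) _ (mem_set (kS u)).
pose k2 (u : W) : I := @exist R (fun t => t \in I) _ (mem_set (kI u)).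
pose k (u : W) : S * I := (k1 u, k2 u).
exists W, S, a, e, h; split => //.
- exact: open_nbhs_nbhs.
- split.
    move=> [u s]; apply: cvg_set_type => /=.
    have Wu : W (\val u) by have [] := set_mem (valP u).
    have Is : a - e < \val s < a + e by apply/Iin; apply: set_mem (valP s).
    apply: (@continuous2_cvg _ _ _ _ _ _ _ _ P); first exact: cP.
      by apply: (cvg_comp _ _ cvg_fst); apply: val_set_type_continuous.
    by apply: (cvg_comp _ _ cvg_snd); apply: val_set_type_continuous.
  exists k; split.
  + move=> u; have Wu := set_mem (valP u).
    apply: (@cvg_pair _ _ _ (nbhs u) (nbhs (k1 u)) (nbhs (k2 u)) _ _ _ k1 k2);
      apply: cvg_set_type => /=.
      apply: (@continuous2_cvg _ _ _ _ _ _ _ _ P); [exact: cP| |exact: cvg_cst].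
      exact: val_set_type_continuous.
    apply: (cvg_comp _ _ (@val_set_type_continuous _ W u)); exact: cg.
  + move=> [u s]; have [Wu gu] := set_mem (valP u).
    have Is : a - e < \val s < a + e by apply/Iin; apply: set_mem (valP s).
    congr pair; apply: val_inj => /=; last by have [] := WP _ _ Wu Is.
    by rewrite PP// -gu P1.
  + move=> u; have Wu := set_mem (valP u); apply: val_inj => /=.
    by rewrite PP ?P1//; apply: WI.
- move=> [u s]/=; have [Wu gu] := set_mem (valP u).
  by apply: (WP _ _ Wu _).2; apply/Iin; apply: set_mem (valP s).
Qed.

(** The flow on the quotient sends [q] to the class of [P (repr q) s]. By equivariance the choice of
    representative does not matter, and since the projection is open, joint continuity passes from
    [P] to the induced flow. *)
Lemma regular_of_equivariant_flow (R : realType) (M : topologicalType)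
    (Q0 : quotType M) (g : M -> R)
    (W : set M) (a e : R) (P : M -> R -> M) (x : M) :
  let Q : topologicalType := quotient_topology Q0 in
  let pi : M -> Q := \pi_(quotient_topology Q0)%qT in
  (forall A : set M, open A -> open [set v | exists2 u, A u & pi u = pi v]) ->
  (forall u v, pi u = pi v -> g u = g v) ->
  (forall u v, pi u = pi v -> W u -> W v) ->
  (forall u v s, pi u = pi v -> W u -> a - e < s < a + e ->
    pi (P u s) = pi (P v s)) ->
  0 < e -> continuous g -> open W ->
  (forall u, W u -> a - e < g u < a + e) ->
  (forall u s, W u -> a - e < s < a + e -> W (P u s) /\ g (P u s) = s) ->
  (forall u, W u -> P u (g u) = u) ->
  (forall u s t, W u -> a - e < s < a + e -> a - e < t < a + e ->
    P (P u s) t = P u t) ->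
  (forall u s, W u -> a - e < s < a + e ->
    {for (u, s), continuous (fun p : M * R => P p.1 p.2)}) ->
  W x -> topologically_regular (fun q : Q => g (repr q)) (pi x).
Proof.
move=> Q pi piO gpi Wpi Ppi e0 cg oW WI WP P1 PP cP Wx.
have piK (q : Q) : pi (repr q) = q by exact: reprK.
have Wr u : W (repr (pi u)) <-> W u by split; apply: Wpi; rewrite piK.
have WrP u s : W u -> a - e < s < a + e -> W (repr (pi (P u s))).
  by move=> Wu Is; apply/Wr; have [] := WP _ _ Wu Is.
apply: (@regular_of_flow _ _ _ [set q : Q | W (repr q)] a e
          (fun q s => pi (P (repr q) s))) => //.
- apply/quotient_continuous; rewrite (_ : _ \o _ = g)//.
  by apply/funext => u /=; apply: gpi; rewrite piK.
- rewrite /open/= /quotient_open.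
  rewrite (_ : _ @^-1` _ = W)//; apply/seteqP.
  by split=> u /=; [move=> /Wr|move=> Wu; apply/Wr].
- by move=> q /= /WI.
- move=> q s /= Wq Is; split; first exact: WrP.
  by rewrite (gpi _ (P (repr q) s)) ?piK//; have [] := WP _ _ Wq Is.
- move=> q Wq /=; rewrite P1 ?piK//.
- move=> q s t /= Wq Is It.
  rewrite (Ppi _ (P (repr q) s)) ?piK//; last exact: WrP.
  by rewrite PP.
- move=> q s /= Wq Is B /= nB.
  have nB' : nbhs (P (repr q) s) (pi @^-1` B).
    exact: (@pi_continuous _ Q0).
  have [[N J] /= [nN nJ] NJ] := cP _ _ Wq Is _ nB'.
  move: nN; rewrite nbhsE => -[N' [oN' N'q N'N]].
  have nW : nbhs (repr q) W by apply: open_nbhs_nbhs.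
  pose N2 := N' `&` W.
  have oN2 : open N2 by apply: openI.
  (* The image of [N2] is open because [pi] is. For [q'] in it, the flow may be computed at a
     representative in [N2] instead of at [repr q']. *)
  exists ([set q' : Q | exists2 u, N2 u & pi u = q'], J `&` `](a - e), (a + e)[%classic) => /=.
    split; last first.
      by apply: filterI => //; apply: near_in_itvoo; rewrite in_itv.
    apply: open_nbhs_nbhs; split; last by exists (repr q); [split|exact: piK].
    by rewrite /open/= /quotient_open; apply: (piO _ oN2).
  move=> [q' t] /= [[u [N'u Wu] <-] [Jt]]; rewrite in_itv/= => It.
  rewrite (Ppi _ u) ?piK//; last exact/Wr.
  by apply: (NJ (u, t)); split => //; apply: N'N.
- exact/Wr.
Qed.

(** * Scalars with a real modulus, and the norm along rays *)

(** The compact unit ball is the source of the positive minimum in [coord_bounded], and thus of the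
    continuity of coordinates on [X]. *)
Record real_scalars (R : realType) (K : numFieldType) := RealScalars {
  emb : {rmorphism R -> K};
  mdl : K -> R;
  mdlE : forall x, emb (mdl x) = `|x|;
  emb_le : forall r s, (emb r <= emb s) = (r <= s);
  unit_ball_compact : compact [set x : K | `|x| <= 1]
}.

Section RealNorm.
Variables (R : realType) (K : numFieldType) (m : real_scalars R K).
Variable X : normedModType K.
Local Notation emb := (emb m).
Local Notation mdl := (mdl m).

Definition nrm (V : normedModType K) (x : V) : R := mdl `|x|.

Lemma emb_inj : injective emb. Proof. exact: fmorph_inj. Qed.

Lemma emb_lt r s : (emb r < emb s) = (r < s).
Proof. by rewrite !lt_def emb_le (inj_eq emb_inj). Qed.

Lemma mdl_ge0 x : 0 <= mdl x.
Proof. by rewrite -(emb_le m) mdlE rmorph0. Qed.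

Lemma mdlM x y : mdl (x * y) = mdl x * mdl y.
Proof. by apply: emb_inj; rewrite rmorphM/= !mdlE normrM. Qed.

Lemma mdl1 : mdl 1 = 1.
Proof. by apply: emb_inj; rewrite mdlE rmorph1 normr1. Qed.

Lemma mdl_eq0 x : (mdl x == 0) = (x == 0).
Proof. by rewrite -(inj_eq emb_inj) mdlE rmorph0 normr_eq0. Qed.

Lemma mdl0 : mdl 0 = 0.
Proof. by apply/eqP; rewrite mdl_eq0. Qed.

Lemma mdl_gt0 x : (0 < mdl x) = (x != 0).
Proof. by rewrite lt_def mdl_ge0 andbT mdl_eq0. Qed.

Lemma mdlV x : mdl x^-1 = (mdl x)^-1.
Proof. by apply: emb_inj; rewrite fmorphV/= !mdlE normfV. Qed.

Lemma mdl_emb r : mdl (emb r) = `|r|.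
Proof.
apply: emb_inj; rewrite mdlE; case: (leP 0 r) => r0.
  by rewrite (ger0_norm r0) ger0_norm// -(rmorph0 emb) emb_le.
by rewrite (ltr0_norm r0) ltr0_norm ?rmorphN// -(rmorph0 emb) emb_lt.
Qed.

Lemma nrmE (V : normedModType K) (x : V) : emb (nrm x) = `|x|.
Proof. by rewrite mdlE normr_id. Qed.

Lemma nrm_ge0 (V : normedModType K) (x : V) : 0 <= nrm x.
Proof. exact: mdl_ge0. Qed.

Lemma nrm_eq0 (V : normedModType K) (x : V) : (nrm x == 0) = (x == 0).
Proof. by rewrite mdl_eq0 normr_eq0. Qed.

Lemma nrmD (V : normedModType K) (x y : V) : nrm (x + y) <= nrm x + nrm y.
Proof. by rewrite -(emb_le m) rmorphD/= !nrmE ler_normD. Qed.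

Lemma nrmZ (V : normedModType K) k (x : V) : nrm (k *: x) = mdl k * nrm x.
Proof. by apply: emb_inj; rewrite rmorphM/= !nrmE mdlE normrZ. Qed.

Lemma nrmN (V : normedModType K) (x : V) : nrm (- x) = nrm x.
Proof. by apply: emb_inj; rewrite !nrmE normrN. Qed.

Lemma nrm_dist (V : normedModType K) (x y : V) : `|nrm x - nrm y| <= nrm (x - y).
Proof.
have H (u v : V) : nrm u - nrm v <= nrm (u - v).
  by rewrite lerBlDr; apply: le_trans (nrmD _ _); rewrite subrK.
by rewrite ler_norml H andbT lerNl opprB -(nrmN (x - y)) opprB H.
Qed.

(** Real tolerances suffice, because every positive [e] in [K] equals [emb (mdl e)]. *)
Lemma cvg_nrmP (V : normedModType K) (T : Type) (F : set_system T) (f : T -> V) (y : V) :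
  Filter F ->
  f @ F --> y <-> (forall e : R, 0 < e -> \forall x \near F, nrm (y - f x) < e).
Proof.
move=> FF; split.
  move=> /cvgrPdist_lt H e e0; have := H (emb e); rewrite -(rmorph0 emb) emb_lt.
  by move=> /(_ e0); apply: filterS => x; rewrite -nrmE emb_lt.
move=> H; apply/cvgrPdist_lt => e e0.
have eE : e = emb (mdl e) by rewrite mdlE gtr0_norm.
have /H : 0 < mdl e by rewrite mdl_gt0 gt_eqF.
by apply: filterS => x; rewrite -emb_lt -eE nrmE.
Qed.

Lemma cvg_nrm (V : normedModType K) (T : Type) (F : set_system T) (f : T -> V) (y : V) :
  Filter F -> f @ F --> y -> nrm (f x) @[x --> F] --> nrm y.
Proof.
move=> FF /cvg_nrmP H; apply/cvgrPdist_lt => e /H.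
by apply: filterS => x; apply: le_lt_trans; exact: nrm_dist.
Qed.

Lemma cvg_mdl (T : Type) (F : set_system T) (f : T -> K) (y : K) :
  Filter F -> f @ F --> y -> mdl (f x) @[x --> F] --> mdl y.
Proof.
have E z : mdl z = nrm (z : K^o) by apply: emb_inj; rewrite nrmE mdlE.
by move=> FF /(@cvg_nrm K^o)/=; under eq_fun do rewrite -E; rewrite -E.
Qed.

Lemma mdl_continuous : continuous mdl.
Proof. by move=> x; exact: (@cvg_mdl _ (nbhs x) id x _ cvg_id). Qed.

Lemma cvg_emb (T : Type) (F : set_system T) (f : T -> R) (y : R) :
  Filter F -> f @ F --> y -> emb (f x) @[x --> F] --> emb y.
Proof.
move=> FF /cvgrPdist_lt H; apply/(@cvg_nrmP K^o) => e /H.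
apply: filterS => x; rewrite -rmorphB -emb_lt.
by rewrite -(emb_lt (nrm _)) nrmE -(mdlE m) mdl_emb.
Qed.

Definition ray (z y : X) (r : R) : X := z + emb r *: (y - z).

Lemma ray_convex z y q r :
  ray z y (q * r) = emb (1 - q) *: z + emb q *: ray z y r.
Proof.
rewrite /ray [in RHS]scalerDr scalerA -rmorphM addrA -scalerDl -rmorphD.
by rewrite subrK rmorph1 scale1r.
Qed.

Lemma ray_scale (th : K) z y r :
  ray (th *: z) (th *: y) r = th *: ray z y r.
Proof. by rewrite /ray -scalerBr [RHS]scalerDr !scalerA mulrC. Qed.

(** The point at [r] is a convex combination of [z] and the point at [s]. The weight [1 - r / s] of
    [z] is positive, so the strict bound on [z] makes the result strict. *)
Lemma nrm_ray_lt z y r s t : 0 <= r < s -> nrm z < t -> nrm (ray z y s) <= t ->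
  nrm (ray z y r) < t.
Proof.
move=> /andP[r0 rs] zt st; have s0 : 0 < s by exact: le_lt_trans rs.
have -> : r = (r / s) * s by rewrite divfK ?gt_eqF.
have q1 : r / s < 1 by rewrite ltr_pdivrMr ?mul1r.
have q0 : 0 <= r / s by rewrite divr_ge0// ltW.
rewrite ray_convex; apply: le_lt_trans (nrmD _ _) _.
rewrite !nrmZ !mdl_emb !ger0_norm// ?subr_ge0 ?(ltW q1)//.
have -> : t = (1 - r / s) * t + r / s * t by rewrite -mulrDl subrK mul1r.
by apply: ltr_leD; [rewrite ltr_pM2l ?subr_gt0|rewrite ler_wpM2l].
Qed.

Definition hit_set (z y : X) (t : R) : set R :=
  [set r | 0 < r /\ nrm (ray z y r) = t].

(** The default [0] is not in [hit_set]. The value is meaningful when [nrm z < t] and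
    [nrm z < nrm y], by [hit_ex] and [hit_set_uniq]. *)
Definition hit (z y : X) (t : R) : R := xget 0 (hit_set z y t).

Lemma cvg_ray (T : Type) (F : set_system T) (z y : T -> X) (r : T -> R) z0 y0 r0 :
  Filter F -> z @ F --> z0 -> y @ F --> y0 -> r @ F --> r0 ->
  ray (z x) (y x) (r x) @[x --> F] --> ray z0 y0 r0.
Proof.
move=> FF zz yy rr; apply: cvgD => //; apply: cvgZ; first exact: cvg_emb.
exact: cvgB.
Qed.

Lemma hit_set_uniq z y t r s : nrm z < t ->
  hit_set z y t r -> hit_set z y t s -> r = s.
Proof.
move=> zt [r0 rt] [s0 st]; case: (ltgtP r s) => // rs.
  by have := @nrm_ray_lt z y r s t; rewrite (ltW r0) rs zt st
    lexx rt ltxx => /(_ erefl erefl erefl).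
by have := @nrm_ray_lt z y s r t; rewrite (ltW s0) rs zt st
    rt lexx ltxx => /(_ erefl erefl erefl).
Qed.

(** The norm along the ray starts below [t] and is unbounded since [y] differs from [z], so the
    intermediate value theorem applies. *)
Lemma hit_ex z y t : nrm z < t -> nrm z < nrm y -> hit_set z y t (hit z y t).
Proof.
move=> zt zy; apply: xgetPex.
have yz0 : 0 < nrm (y - z).
  rewrite lt_def nrm_ge0 andbT nrm_eq0 subr_eq0.
  by apply: contraTneq zy => ->; rewrite ltxx.
(* By the triangle inequality the norm at parameter [B] is at least [B * nrm (y - z) - nrm z], which
   is [t]. *)
pose B := (t + nrm z) / nrm (y - z).
have t0 : 0 < t by apply: le_lt_trans zt; exact: nrm_ge0.
have B0 : 0 <= B by rewrite divr_ge0 ?nrm_ge0// addr_ge0 ?nrm_ge0// ltW.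
have FB : t <= nrm (ray z y B).
  have := nrmD (ray z y B) (- z); rewrite nrmN /ray addrAC subrr add0r nrmZ.
  by rewrite mdl_emb ger0_norm// divfK ?gt_eqF// lerD2r.
have F0 : nrm (ray z y 0) = nrm z by rewrite /ray rmorph0 scale0r addr0.
have [|||r] := @IVT R (fun r => nrm (ray z y r)) 0 B t => //.
- apply: continuous_subspaceT => r; apply: cvg_nrm; apply: cvg_ray => //; exact: cvg_cst.
- by rewrite F0 ge_min (ltW zt) le_max FB orbT.
- rewrite in_itv/= => /andP[r0 _] rt; exists r; split => //.
  by rewrite lt_def r0 andbT; apply: contraTneq zt => rE; rewrite -rt rE F0 ltxx.
Qed.

(** This equivalence and [hit_lt] turn bounds on the hitting parameter into strict inequalities
    between continuous quantities, from which its continuity follows. *)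
Lemma hit_gt z y t r : nrm z < t -> nrm z < nrm y -> 0 <= r ->
  (r < hit z y t) = (nrm (ray z y r) < t).
Proof.
move=> zt zy r0; have [h0 ht] := hit_ex zt zy.
apply/idP/idP => H.
  by apply: (@nrm_ray_lt z y r (hit z y t)); rewrite ?r0 ?ht.
rewrite ltNge; apply/negP => hr.
case: (ltgtP (hit z y t) r) hr => // [hr _|hr _]; last by rewrite -hr ht ltxx in H.
by have := @nrm_ray_lt z y _ r _ (_ : 0 <= hit z y t < r) zt (ltW H);
  rewrite hr ltW// ht ltxx => /(_ erefl).
Qed.

Lemma hit_lt z y t r : nrm z < t -> nrm z < nrm y -> 0 <= r ->
  (hit z y t < r) = (t < nrm (ray z y r)).
Proof.
move=> zt zy r0; have [h0 ht] := hit_ex zt zy.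
case: (ltgtP (hit z y t) r) => [hr|hr|<-].
- apply/esym; rewrite ltNge; apply/negP => H.
  by have := @nrm_ray_lt z y _ r _ (_ : 0 <= hit z y t < r) zt H;
    rewrite hr ltW// ht ltxx => /(_ erefl).
- by apply/esym/negbTE; rewrite -leNgt; move: hr; rewrite hit_gt// => /ltW.
- by rewrite ht ltxx.
Qed.

(** The norm exceeds [t0] slightly after the hitting parameter and is below [t0] slightly before it.
    Both inequalities persist nearby and enclose the perturbed parameter. *)
Lemma cvg_hit (T : Type) (F : set_system T) (z y : T -> X) (t : T -> R) z0 y0 t0 :
  Filter F -> z @ F --> z0 -> y @ F --> y0 -> t @ F --> t0 ->
  nrm z0 < t0 -> nrm z0 < nrm y0 ->
  hit (z x) (y x) (t x) @[x --> F] --> hit z0 y0 t0.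
Proof.
move=> FF cz cy ct zt zy; apply/cvgrPdist_lt => e e0.
have [h0 ht] := hit_ex zt zy; set h := hit z0 y0 t0 in h0 ht *.
have near_lt (f g : T -> R) a b : f @ F --> a -> g @ F --> b -> a < b ->
    \forall x \near F, f x < g x.
  move=> fa gb ab; have : (g x - f x) @[x --> F] --> b - a by exact: cvgB.
  move=> /cvgr_gt /(_ 0); rewrite subr_gt0 => /(_ ab).
  by apply: filterS => x; rewrite subr_gt0.
have n1 : \forall x \near F, nrm (z x) < t x by apply: near_lt zt => //; exact: cvg_nrm.
have n2 : \forall x \near F, nrm (z x) < nrm (y x).
  by apply: near_lt zy; exact: cvg_nrm.
have n3 : \forall x \near F, t x < nrm (ray (z x) (y x) (h + e)).
  apply: (near_lt _ _ t0 (nrm (ray z0 y0 (h + e)))) => //.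
    by apply: cvg_nrm; apply: cvg_ray => //; exact: cvg_cst.
  by rewrite -hit_lt ?ltrDl// addr_ge0// ltW.
pose l := Num.max 0 (h - e).
have l0 : 0 <= l by rewrite le_max lexx.
have n4 : \forall x \near F, nrm (ray (z x) (y x) l) < t x.
  apply: (near_lt _ _ (nrm (ray z0 y0 l)) t0) => //.
    by apply: cvg_nrm; apply: cvg_ray => //; exact: cvg_cst.
  by rewrite -hit_gt// gt_max h0 gtrBl.
near=> x.
have zt' : nrm (z x) < t x by near: x.
have zy' : nrm (z x) < nrm (y x) by near: x.
rewrite ltr_distlC; apply/andP; split.
  have : l < hit (z x) (y x) (t x) by rewrite hit_gt//; near: x.
  by apply: le_lt_trans; rewrite le_max lexx orbT.
rewrite hit_lt//; first by near: x.
by rewrite addr_ge0// ltW.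
Unshelve. all: by end_near. Qed.

End RealNorm.

(** * Convergence in products, of finite sums and of determinants *)

Lemma cvg_eval (I : eqType) (V : topologicalType) (T : Type) (F : set_system T)
    (f : T -> {ptws I -> V}) (g : {ptws I -> V}) (i : I) :
  Filter F -> f @ F --> g -> f x i @[x --> F] --> g i.
Proof.
move=> FF fg; apply: (cvg_comp f (fun h : {ptws I -> V} => h i) fg).
exact: (@proj_continuous I (fun=> V) i g).
Qed.

Lemma cvg_ptws (I : eqType) (V : topologicalType) (T : Type) (F : set_system T)
    (f : T -> {ptws I -> V}) (g : {ptws I -> V}) :
  Filter F -> (forall i, f x i @[x --> F] --> g i) -> f @ F --> g.
Proof.
move=> FF fg; apply/cvg_sup => i A [_ [] [B oB <- Bg BA]].
have : nbhs (g i) B by apply: open_nbhs_nbhs.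
by move/fg; apply: (@filterS _ F) => x /= Bx; exact: BA.
Qed.

Lemma cvg_bigsum (K : numFieldType) (V : normedModType K) (T I : Type)
    (F : set_system T) (r : seq I) (f : I -> T -> V) (a : I -> V) :
  Filter F -> (forall i, f i @ F --> a i) ->
  \sum_(i <- r) f i x @[x --> F] --> \sum_(i <- r) a i.
Proof.
move=> FF fa; elim: r => [|i r IH].
  by under eq_fun do rewrite big_nil; rewrite big_nil; exact: cvg_cst.
by under eq_fun do rewrite big_cons; rewrite big_cons; exact: cvgD.
Qed.

Lemma cvg_bigprod (K : numFieldType) (T I : Type)
    (F : set_system T) (r : seq I) (f : I -> T -> K) (a : I -> K) :
  Filter F -> (forall i, f i @ F --> a i) ->
  \prod_(i <- r) f i x @[x --> F] --> \prod_(i <- r) a i.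
Proof.
move=> FF fa; elim: r => [|i r IH].
  by under eq_fun do rewrite big_nil; rewrite big_nil; exact: cvg_cst.
by under eq_fun do rewrite big_cons; rewrite big_cons; exact: cvgM.
Qed.

Lemma cvg_det (K : numFieldType) (T : Type) (F : set_system T) n
    (f : T -> 'M[K]_n) (A : 'M[K]_n) :
  Filter F -> (forall i j, f x i j @[x --> F] --> A i j) ->
  \det (f x) @[x --> F] --> \det A.
Proof.
move=> FF fA; apply: (@cvg_bigsum K K^o) => s.
by apply: cvgM; [exact: cvg_cst|apply: cvg_bigprod => i; exact: fA].
Qed.

(** * Continuity of linear coordinates *)

Section Coordinates.
Variables (R : realType) (K : numFieldType) (m : real_scalars R K).
Variables (X : normedModType K) (n : nat) (phi : {linear X -> 'rV[K]_n}).
Hypothesis phi_bij : bijective phi.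
Local Notation mdl := (mdl m).
Local Notation nrm := (nrm m).

Let phi_inj : injective phi. Proof. exact: bij_inj. Qed.

(** On the compact set of coefficients of modulus at most one whose [j]-th one has modulus exactly
    one, the norm has a positive minimum [c j]. Dividing a vector by its largest coordinate brings
    it into one of these sets. *)
Lemma coord_bounded :
  exists2 C : R, 0 <= C & forall x j, mdl (phi x 0 j) <= C * nrm x.
Proof.
have [psi phiK psiK] := phi_bij.
pose e i := psi (delta_mx 0 i).
pose sum (a : {ptws 'I_n -> K}) : X := \sum_(i < n) a i *: e i.
have phi_sum a : phi (sum a) = \row_i a i.
  rewrite linear_sum/= [RHS]row_sum_delta; apply: eq_bigr => i _.
  by rewrite linearZ/= psiK mxE.
pose A (j i : 'I_n) : set K := if i == j then [set x | `|x| <= 1] `&` [set x | mdl x = 1]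
                      else [set x | `|x| <= 1].
pose C j := [set a : {ptws 'I_n -> K} | forall i, A j i (a i)].
have cC j : compact (C j).
  apply: (@tychonoff 'I_n (fun=> K) (A j)) => i; rewrite /A; case: ifP => _.
    apply: compact_closedI; first exact: unit_ball_compact m.
    rewrite (_ : [set x | _] = mdl @^-1` [set 1])//.
    apply: closed_comp => [x _|]; first exact: mdl_continuous.
    exact: closed_eq.
  exact: unit_ball_compact m.
have csum : continuous (fun a => nrm (sum a)).
  move=> a; apply: (@cvg_nrm _ _ m X _ (nbhs a) sum (sum a)).
  apply: (@cvg_bigsum K X _ _ _ _ (fun i (b : {ptws 'I_n -> K}) => b i *: e i)
            (fun i => a i *: e i)) => i.
  by apply: cvgZ; [exact: (@proj_continuous 'I_n (fun=> K) i a)|exact: cvg_cst].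
have min j : exists2 c : R, 0 < c & forall a, C j a -> c <= nrm (sum a).
  have [||a aC amin] := @compact_EVT_min _ R (fun a => nrm (sum a)) (C j) _ (cC j).
  - exists (fun=> 1) => i; rewrite /A; case: ifP => _; last by rewrite /= normr1.
    by split; rewrite /= ?normr1 ?mdl1.
  - by apply: continuous_subspaceT; exact: csum.
  exists (nrm (sum a)); last by move=> b Cb; apply: amin; apply: mem_set.
  rewrite lt_def nrm_ge0 andbT nrm_eq0; apply/negP => /eqP sa0.
  have := set_mem aC j; rewrite /A eqxx => -[_ /=].
  have := phi_sum a; rewrite sa0 linear0 => /rowP /(_ j); rewrite !mxE => <-.
  by rewrite mdl0 => /eqP; rewrite eq_sym oner_eq0.
have [c c0 cP] : exists2 c : 'I_n -> R, (forall j, 0 < c j) &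
    forall j a, C j a -> c j <= nrm (sum a).
  exists (fun j => s2val (cid2 (min j))) => j; first exact: s2valP (cid2 (min j)).
  exact: s2valP' (cid2 (min j)).
(* The sum dominates every [(c j)^-1], so one constant serves whichever coordinate is largest. *)
exists (\sum_j (c j)^-1); first by apply: sumr_ge0 => j _; rewrite invr_ge0 ltW.
move=> x k.
pose j := [arg max_(i > k) mdl (phi x 0 i)]%O.
have jmax i : mdl (phi x 0 i) <= mdl (phi x 0 j).
  by rewrite /j; case: Order.TotalTheory.arg_maxP => // l _; exact.
apply: le_trans (jmax k) _.
have [->|xj0] := eqVneq (phi x 0 j) 0.
  by rewrite mdl0 mulr_ge0 ?nrm_ge0//; apply: sumr_ge0 => i _; rewrite invr_ge0 ltW.
have xj : 0 < mdl (phi x 0 j) by rewrite mdl_gt0.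
pose a i : K := phi x 0 i / phi x 0 j.
have Ca : C j a.
  have a1 i : `|a i| <= 1.
    by rewrite -(mdlE m) -(rmorph1 (emb m)) emb_le /a mdlM mdlV ler_pdivrMr// mul1r.
  move=> i; rewrite /A; case: ifP => [/eqP ->|_]; last exact: a1.
  by split; [exact: a1|rewrite /= /a divff// mdl1].
have -> : nrm x = mdl (phi x 0 j) * nrm (sum a).
  rewrite -nrmZ; congr (nrm _); apply: phi_inj; rewrite linearZ/= phi_sum.
  by apply/rowP => i; rewrite !mxE mulrC divfK.
rewrite mulrCA ler_peMr ?mdl_ge0//.
apply: le_trans (_ : (c j)^-1 * nrm (sum a) <= _).
  by rewrite mulrC ler_pdivlMr// mul1r; exact: cP.
rewrite ler_wpM2r ?nrm_ge0// (bigD1 j)//= lerDl.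
by apply: sumr_ge0 => i _; rewrite invr_ge0 ltW.
Qed.

Lemma coord_continuous j : continuous (fun x => phi x 0 j).
Proof.
have [C C0 bC] := coord_bounded => x.
apply/(@cvg_nrmP _ _ m K^o) => e e0.
have C1 : 0 < C + 1 by rewrite ltr_wpDl.
have : \forall y \near x, nrm (x - y) < e / (C + 1).
  have /(@cvg_nrmP _ _ m) := @cvg_id _ (nbhs x).
  by apply; rewrite divr_gt0.
apply: filterS => y; rewrite ltr_pdivlMr// => xy.
have -> : nrm (phi x 0 j - phi y 0 j : K^o) = mdl (phi (x - y) 0 j).
  by apply: (emb_inj (m := m)); rewrite nrmE mdlE linearB !mxE.
apply: le_lt_trans (bC _ _) _; apply: le_lt_trans xy.
by rewrite mulrC ler_wpM2l ?nrm_ge0// lerDl.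
Qed.

End Coordinates.

(** * Replacing one vector of a frame, and Auerbach bases *)

Section Replacement.
Variables (R : realType) (K : numFieldType) (m : real_scalars R K).
Variables (X : normedModType K) (n : nat) (phi : {linear X -> 'rV[K]_n}).
Hypothesis phi_bij : bijective phi.
Local Notation mdl := (mdl m).
Local Notation nrm := (nrm m).
Implicit Types (u v : 'I_n -> X) (x w : X).

Definition upd u (j : 'I_n) x : 'I_n -> X := fun k => if k == j then x else u k.

Definition ldet u j x : K := \det (rows phi (upd u j x)).

Lemma upd_same u j x : upd u j x j = x. Proof. by rewrite /upd eqxx. Qed.

Lemma upd_other u j x k : k != j -> upd u j x k = u k.
Proof. by rewrite /upd => /negbTE ->. Qed.

Lemma upd_upd u j x y : upd (upd u j x) j y = upd u j y.
Proof. by apply/funext => k; rewrite /upd; case: eqP. Qed.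

Lemma upd_id u j : upd u j (u j) = u.
Proof. by apply/funext => k; rewrite /upd; case: eqP => // ->. Qed.

Lemma ldet_self u j : ldet u j (u j) = \det (rows phi u).
Proof. by rewrite /ldet upd_id. Qed.

Lemma ldet_upd u j x y : ldet (upd u j x) j y = ldet u j y.
Proof. by rewrite /ldet upd_upd. Qed.

Lemma ldet_is_linear u j : linear (ldet u j : X -> K^o).
Proof.
move=> a x y; rewrite /ldet.
rewrite (@determinant_multilinear _ _ _ (rows phi (upd u j x))
  (rows phi (upd u j y)) j a 1) ?mul1r// ?scale1r.
- by rewrite !rowK !upd_same linearP.
- by apply/matrixP => k l; rewrite !mxE !upd_other// eq_sym neq_lift.
- by apply/matrixP => k l; rewrite !mxE !upd_other// eq_sym neq_lift.
Qed.

HB.instance Definition _ u j :=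
  GRing.isLinear.Build K X K^o *:%R (ldet u j) (ldet_is_linear u j).

Lemma ldet_other u j k : k != j -> ldet u j (u k) = 0.
Proof.
move=> kj; rewrite /ldet; apply: (determinant_alternate kj) => l.
by rewrite !mxE upd_same upd_other.
Qed.

Lemma cvg_upd (T : Type) (F : set_system T) (u : T -> {ptws 'I_n -> X})
    (x : T -> X) (u0 : {ptws 'I_n -> X}) x0 j :
  Filter F -> u @ F --> u0 -> x @ F --> x0 ->
  (upd (u t) j (x t) : {ptws 'I_n -> X}) @[t --> F] --> (upd u0 j x0 : {ptws 'I_n -> X}).
Proof.
move=> FF cu cx; apply: cvg_ptws => k; rewrite /upd; case: eqP => // _.
apply: (cvg_comp u (fun h : {ptws 'I_n -> X} => h k) cu).
exact: (@proj_continuous 'I_n (fun=> X) k u0).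
Qed.

Lemma cvg_det_rows (T : Type) (F : set_system T) (u : T -> {ptws 'I_n -> X})
    (u0 : {ptws 'I_n -> X}) :
  Filter F -> u @ F --> u0 ->
  \det (rows phi (u t)) @[t --> F] --> \det (rows phi u0).
Proof.
move=> FF cu; apply: cvg_det => i j; rewrite !mxE.
under eq_fun do rewrite mxE.
apply: (cvg_comp (fun t => u t i) (fun x => phi x 0 j)).
  apply: (cvg_comp u (fun h : {ptws 'I_n -> X} => h i) cu).
  exact: (@proj_continuous 'I_n (fun=> X) i u0).
exact: (coord_continuous m phi_bij).
Qed.

Lemma cvg_ldet (T : Type) (F : set_system T) (u : T -> {ptws 'I_n -> X})
    (x : T -> X) (u0 : {ptws 'I_n -> X}) x0 j :
  Filter F -> u @ F --> u0 -> x @ F --> x0 ->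
  ldet (u t) j (x t) @[t --> F] --> ldet u0 j x0.
Proof. by move=> FF cu cx; apply: cvg_det_rows; apply: cvg_upd. Qed.

Lemma rows_basis v : \det (rows phi v) != 0 -> is_basis [set: X] v.
Proof.
move=> dv; split => // x _.
have Av : rows phi v \in unitmx by rewrite unitmxE unitfE.
have phi_inj : injective phi by exact: bij_inj.
have phiS (c : 'rV[K]_n) : phi (\sum_(i < n) c 0 i *: v i) = c *m rows phi v.
  rewrite linear_sum/= mulmx_sum_row; apply: eq_bigr => i _.
  by rewrite linearZ/= rowK.
exists (phi x *m invmx (rows phi v)); split.
  by apply: phi_inj; rewrite phiS mulmxKV.
by move=> c xE; rewrite xE phiS mulmxK.
Qed.

(* By Cramer's rule the [x |-> ldet v i x / det v] are the functionals dual to [v]. *)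
Lemma auerbach_of_ldet v :
  (forall i, `|v i| = 1) -> \det (rows phi v) != 0 ->
  (forall i x, `|x| <= 1 -> `|ldet v i x| <= `|\det (rows phi v)|) ->
  auerbach v.
Proof.
move=> v1 dv vmax; have bv := rows_basis dv; split => //.
pose f i x : K^o := (\det (rows phi v))^-1 * ldet v i x.
have flin i : linear (f i).
  by move=> a x y; rewrite /f ldet_is_linear mulrDr scalerAr.
have fcont i : continuous (f i).
  move=> x; apply: cvgM; first exact: cvg_cst.
  by apply: cvg_ldet; [exact: cvg_cst|exact: cvg_id].
have fv i j : f i (v j) = (i == j)%:R.
  rewrite /f; have [->|ij] := eqVneq i j; first by rewrite ldet_self mulVf.
  by rewrite ldet_other 1?eq_sym// mulr0.
have fE x : x = \sum_(i < n) f i x *: v i.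
  have [c [xE _]] := bv.2 x Logic.I.
  rewrite {1}xE; apply: eq_bigr => i _; congr (_ *: _).
  pose fL := GRing.isLinear.Build K X K^o *:%R (f i) (flin i).
  pose fi : {linear X -> K^o} := HB.pack (f i) fL.
  have fiE y : fi y = f i y by [].
  rewrite -fiE xE linear_sum (bigD1 i)// linearZ fiE fv eqxx big1.
    by rewrite /= addr0 /GRing.scale/= mulr1.
  move=> j /andP[_ ji]; rewrite linearZ fiE fv eq_sym (negbTE ji).
  exact: mulr0.
exists f; split => //.
- split; first by move=> i; split.
  move=> g [glin gcont].
  pose gL := GRing.isLinear.Build K X K^o *:%R g glin.
  pose gg : {linear X -> K^o} := HB.pack g gL.
  have sumE (c : 'rV[K]_n) x :
      (\sum_(i < n) c 0 i *: f i) x = \sum_(i < n) c 0 i * f i x.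
    by rewrite fct_sumE.
  exists (\row_i g (v i)); split.
    apply/funext => x; rewrite sumE {1}(fE x).
    have ggE y : gg y = g y by [].
    rewrite -ggE linear_sum; apply: eq_bigr => i _.
    by rewrite linearZ mxE ggE; exact: mulrC.
  move=> c gE; apply/rowP => j; rewrite mxE gE sumE (bigD1 j)//= fv eqxx mulr1.
  by rewrite big1 ?addr0// => i ij; rewrite fv (negbTE ij) mulr0.
- move=> i; split; first by split.
  split=> [_ [x /= x1 <-]|y yub].
    rewrite /f normrM normfV mulrC ler_pdivrMr ?normr_gt0// mul1r.
    exact: vmax.
  (* The norm is attained at the unit vector [v i], where [f i] equals one. *)
  by apply: yub => /=; exists (v i); rewrite /= ?v1// fv eqxx normr1.
Qed.

Lemma not_auerbach_ldet v :
  (forall i, `|v i| = 1) -> \det (rows phi v) != 0 -> ~ auerbach v ->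
  exists i x, nrm x <= 1 /\ mdl (\det (rows phi v)) < mdl (ldet v i x).
Proof.
move=> v1 dv nA; apply: contrapT => H; apply: nA.
apply: auerbach_of_ldet => // i x x1; rewrite -!(mdlE m) emb_le leNgt.
apply/negP => lt; apply: H; exists i, x; split => //.
by rewrite -(emb_le m) nrmE rmorph1.
Qed.

End Replacement.

(** * Sliding a unit vector to a prescribed level of a linear form *)

Section Slide.
Variables (R : realType) (K : numFieldType) (m : real_scalars R K).
Variables (X : normedModType K).
Local Notation mdl := (mdl m).
Local Notation emb := (emb m).
Local Notation nrm := (nrm m).
Implicit Types (lx lw : K) (x w : X) (s t b : R).

(* On the unit vectors near [x], a linear form [l] is determined up to its phase by
   the norm of [x / l x], because [|l x| = 1 / |x / l x|].  [slide] moves [x] so that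
   [x / l x] runs along the ray from [w / l w], until [|l x| = s];
   [lx] and [lw] are the values of [l]. *)
Definition slide lx lw w x s : X :=
  (lx / emb (mdl lx) * emb s) *:
    ray m (lw^-1 *: w) (lx^-1 *: x) (hit m (lw^-1 *: w) (lx^-1 *: x) s^-1).

(** The bound [b] separates the current level [mdl lx] from [mdl lw]; every positive level below [b]
    can then be reached. *)
Definition slidable b lx lw w x : Prop :=
  [/\ lx != 0, nrm w <= 1, nrm x = 1, mdl lx < b & b < mdl lw].

Section Properties.
Variables (b : R) (lx lw : K) (w x : X).
Hypothesis sl : slidable b lx lw w x.

Let z := lw^-1 *: w.
Let y := lx^-1 *: x.

Let b_gt0 : 0 < b.
Proof. by case: sl => _ _ _ lxb _; apply: le_lt_trans lxb; exact: mdl_ge0. Qed.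

Lemma slidable_lw : lw != 0.
Proof. by case: sl => _ _ _ _; rewrite -(mdl_gt0 m); apply: lt_trans. Qed.

(** The norm of [w / lw] is at most [1 / mdl lw], which is less than [1 / b] and hence less than
    [1 / s]. *)
Lemma nrm_slide_source s : 0 < s < b -> nrm z < s^-1.
Proof.
move=> /andP[s0 sb]; case: sl => _ w1 _ _ blw; rewrite /z nrmZ mdlV.
have lw0 : 0 < mdl lw by apply: lt_trans blw.
rewrite mulrC ltr_pdivrMr// mulrC ltr_pdivlMr//.
apply: le_lt_trans (_ : s < _); last exact: lt_trans blw.
by rewrite ler_piMl// ltW.
Qed.

Let nrm_y : nrm y = (mdl lx)^-1.
Proof. by case: sl => _ _ x1 _ _; rewrite nrmZ x1 mulr1 mdlV. Qed.

Let lx_gt0 : 0 < mdl lx. Proof. by case: sl => lx0 *; rewrite mdl_gt0. Qed.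

Lemma nrm_slide_target : nrm z < nrm y.
Proof. by have [*] := sl; rewrite nrm_y; apply: nrm_slide_source; rewrite lx_gt0. Qed.

Let hitP s : 0 < s < b -> hit_set m z y s^-1 (hit m z y s^-1).
Proof. by move=> sb; apply: hit_ex; [exact: nrm_slide_source|exact: nrm_slide_target]. Qed.

Let phase : K := lx / emb (mdl lx).

Let mdl_phase : mdl phase = 1.
Proof. by rewrite mdlM mdlV mdl_emb ger0_norm ?mdl_ge0// divff ?gt_eqF. Qed.

Lemma nrm_slide s : 0 < s < b -> nrm (slide lx lw w x s) = 1.
Proof.
move=> sb; have [_ h] := hitP sb; have /andP[s0 _] := sb.
by rewrite /slide nrmZ h mdlM mdl_phase mul1r mdl_emb gtr0_norm// divff ?gt_eqF.
Qed.

(** Both [z] and [y] lie in the affine hyperplane [l = 1], and so does the whole ray; only the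
    scalar in front of the ray contributes. *)
Lemma slide_level (l : {linear X -> K^o}) s : l x = lx -> l w = lw ->
  l (slide lx lw w x s) = phase * emb s.
Proof.
move=> xE wE; have lx0 : lx != 0 by case: sl.
have lz : l z = 1 by rewrite linearZ wE; exact: mulVf slidable_lw.
have ly : l y = 1 by rewrite linearZ xE; exact: mulVf lx0.
have lray (p q : X) r : l p = 1 -> l q = 1 -> l (ray m p q r) = 1.
  move=> lp lq; rewrite /ray linearD linearZ linearB lp lq subrr.
  by apply: etrans (addr0 1); congr (_ + _); exact: mulr0.
by rewrite linearZ (lray _ _ _ lz ly); exact: mulr1.
Qed.

Lemma mdl_slide_level s : 0 < s -> mdl (phase * emb s) = s.
Proof. by move=> s0; rewrite mdlM mdl_phase mul1r mdl_emb gtr0_norm. Qed.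

(** At the level [mdl lx] the ray is hit at parameter [1], that is at [x / lx], and the scalar in
    front becomes [lx]. *)
Lemma slide_id : slide lx lw w x (mdl lx) = x.
Proof.
have lxb : 0 < mdl lx < b by have [*] := sl; rewrite lx_gt0.
have lx0 : lx != 0 by case: sl.
have -> : slide lx lw w x (mdl lx) =
    (phase * emb (mdl lx)) *: ray m z y (hit m z y (mdl lx)^-1) by [].
have -> : hit m z y (mdl lx)^-1 = 1.
  apply: (hit_set_uniq (nrm_slide_source lxb) (hitP lxb)); split => //.
  by rewrite /ray rmorph1 scale1r addrC subrK.
rewrite /ray rmorph1 scale1r addrC subrK /phase divfK ?fmorph_eq0 ?gt_eqF//.
by rewrite /y scalerA divff// scale1r.
Qed.

(** After normalisation the slid vector is again a point of the ray from [z] through [y]. The second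
    slide follows the same ray with its parameter rescaled by [h], so uniqueness of the hitting
    point identifies the results. *)
Lemma slide_slide s t : 0 < s < b -> 0 < t < b ->
  slide (phase * emb s) lw w (slide lx lw w x s) t = slide lx lw w x t.
Proof.
move=> sb tb; have /andP[s0 _] := sb; have [h0 hs] := hitP sb.
set h := hit m z y s^-1 in h0 hs.
have es0 : emb s != 0 by rewrite fmorph_eq0 gt_eqF.
have ph0 : phase != 0 by rewrite -(mdl_eq0 m) mdl_phase oner_eq0.
have yE : (phase * emb s)^-1 *: slide lx lw w x s = ray m z y h.
  by rewrite /slide scalerA mulVf ?scale1r// mulf_neq0.
have rayM r : ray m z (ray m z y h) r = ray m z y (r * h).
  by rewrite /ray addrAC subrr add0r scalerA -rmorphM.
have zh : nrm z < nrm (ray m z y h) by rewrite hs; exact: nrm_slide_source.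
have hE : hit m z (ray m z y h) t^-1 * h = hit m z y t^-1.
  have [r0 rt] := hit_ex (nrm_slide_source tb) zh.
  apply: (hit_set_uniq (nrm_slide_source tb) _ (hitP tb)); split; first exact: mulr_gt0.
  by rewrite -rayM.
rewrite [LHS]/slide yE -/z rayM hE mdl_slide_level//.
by rewrite mulfK.
Qed.

End Properties.

Lemma hit_scale (th : K) (z y : X) t : mdl th = 1 ->
  hit m (th *: z) (th *: y) t = hit m z y t.
Proof.
move=> th1; rewrite /hit; congr xget.
by apply/funext => r; rewrite /hit_set /= ray_scale nrmZ th1 mul1r.
Qed.

(** Both ends of the ray are multiplied by the same phase [d / k], which leaves the hitting
    parameter unchanged; the scalar in front gains [k], so [d] remains. *)
Lemma slide_scale (k d : K) lx lw w x s : mdl k = 1 -> mdl d = 1 ->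
  slide (k * lx) (k * d^-1 * lw) w (d *: x) s = d *: slide lx lw w x s.
Proof.
move=> k1 d1; rewrite /slide.
have k0 : k != 0 by rewrite -(mdl_eq0 m) k1 oner_eq0.
have d0 : d != 0 by rewrite -(mdl_eq0 m) d1 oner_eq0.
have -> : (k * d^-1 * lw)^-1 *: w = (d / k) *: (lw^-1 *: w).
  by rewrite scalerA !invfM invrK; congr (_ *: _); rewrite [_ * d]mulrC.
have -> : (k * lx)^-1 *: (d *: x) = (d / k) *: (lx^-1 *: x).
  by rewrite !scalerA invfM; congr (_ *: _); rewrite mulrC mulrA.
have dk1 : mdl (d / k) = 1 by rewrite mdlM mdlV d1 k1 invr1 mulr1.
rewrite hit_scale//.
rewrite ray_scale [mdl (k * lx)]mdlM k1 mul1r !scalerA; congr (_ *: _).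
by set e := (emb _)^-1; field.
Qed.

Lemma cvg_slide (T : Type) (F : set_system T) (lx lw : T -> K) (x : T -> X) (s : T -> R)
    lx0 lw0 w x0 s0 b :
  Filter F -> lx @ F --> lx0 -> lw @ F --> lw0 -> x @ F --> x0 -> s @ F --> s0 ->
  slidable b lx0 lw0 w x0 -> 0 < s0 < b ->
  slide (lx t) (lw t) w (x t) (s t) @[t --> F] --> slide lx0 lw0 w x0 s0.
Proof.
move=> FF clx clw cx cs sl sb; have [lx0n w1 x1 lxb blw] := sl.
have lw0n := slidable_lw sl; have /andP[s0p _] := sb.
have cz : (lw t)^-1 *: w @[t --> F] --> lw0^-1 *: w.
  by apply: cvgZ; [exact: cvgV|exact: cvg_cst].
have cy : (lx t)^-1 *: x t @[t --> F] --> lx0^-1 *: x0.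
  by apply: cvgZ => //; exact: cvgV.
have csV : (s t)^-1 @[t --> F] --> s0^-1 by apply: cvgV => //; rewrite gt_eqF.
apply: cvgZ.
  apply: cvgM; last exact: cvg_emb.
  apply: cvgM => //; apply: cvgV; first by rewrite fmorph_eq0 mdl_eq0.
  by apply: cvg_emb; exact: cvg_mdl.
apply: cvg_ray => //; apply: cvg_hit => //.
  exact: nrm_slide_source sl _ sb.
exact: nrm_slide_target sl.
Qed.

End Slide.

(** * Monomial matrices acting on frames *)

(** All elements of [Bn] and of [NTn] have this form, which allows one treatment of the real and the
    complex action. *)
Definition monomial (K : numDomainType) n (g : 'M[K]_n) : Prop :=
  exists (sg : 'S_n) (d : 'I_n -> K),
    (forall i, `|d i| = 1) /\ forall i j, g i j = if sg i == j then d i else 0.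

Section MonomialAction.
Variables (R : realType) (K : numFieldType) (m : real_scalars R K).
Variables (X : normedModType K) (n : nat) (phi : {linear X -> 'rV[K]_n}).
Local Notation mdl := (mdl m).
Variables (s : 'S_n) (d : 'I_n -> K).
Hypothesis d1 : forall i, mdl (d i) = 1.
Implicit Types u : 'I_n -> X.

Definition monact u : 'I_n -> X := fun i => d i *: u (s i).

(** This is the determinant of the monomial matrix given by [s] and [d]. *)
Definition moncoef : K := (\prod_i d i) * (-1) ^+ s.

Lemma mdl_moncoef : mdl moncoef = 1.
Proof.
apply: (emb_inj (m := m)); rewrite mdlE normrM normr_sign mulr1 normr_prod rmorph1.
by rewrite big1// => i _; rewrite -(mdlE m) d1 rmorph1.
Qed.

Lemma det_monact u : \det (rows phi (monact u)) = moncoef * \det (rows phi u).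
Proof.
have -> : rows phi (monact u) = diag_mx (\row_i d i) *m (perm_mx s *m rows phi u).
  apply/matrixP => i j; rewrite mul_diag_mx -row_permE !mxE linearZ/= mxE.
  by [].
rewrite det_mulmx det_diag det_mulmx det_perm mulrA /moncoef.
by under eq_bigr do rewrite mxE.
Qed.

Lemma upd_monact u j x :
  upd (monact u) j (d j *: x) = monact (upd u (s j) x).
Proof.
apply/funext => k; rewrite /upd /monact (inj_eq perm_inj).
by case: eqP => [->|].
Qed.

(** The factor [(d j)^-1] appears because [x] enters row [j] without the phase [d j] that the action
    puts there. *)
Lemma ldet_monact u j x :
  ldet phi (monact u) j x = moncoef * (d j)^-1 * ldet phi u (s j) x.
Proof.
have dj : d j != 0 by rewrite -(mdl_eq0 m) d1 oner_eq0.
rewrite -{1}[x](scale1r x) -(divff dj) -scalerA /ldet upd_monact det_monact.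
by rewrite -mulrA -[in RHS]/(ldet phi u (s j) x) -[X in _ * X]/(ldet phi u (s j) _) linearZ.
Qed.

End MonomialAction.

(** * The local flow on frames and on their orbits *)

Section Flow.
Variables (R : realType) (K : numFieldType) (m : real_scalars R K).
Variables (X : normedModType K) (n : nat) (phi : {linear X -> 'rV[K]_n}).
Hypothesis phi_bij : bijective phi.
Local Notation mdl := (mdl m).
Local Notation emb := (emb m).
Local Notation nrm := (nrm m).
Implicit Types (u v : 'I_n -> X) (x : X).

Variables (w : X) (f : {linear X -> K^o}) (delta a e : R).
Hypotheses (w1 : nrm w <= 1) (f_cont : continuous f).
Hypotheses (e0 : 0 < e) (ae : 0 < a - e).
Hypothesis delta_small : forall u, (forall i, `|u i| = 1) ->
  (forall i, mdl (f (u i)) < delta) -> mdl (\det (rows phi u)) <= a - e.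

Local Notation dt u := (\det (rows phi u)).

Definition absdet (u : frames phi) : R := mdl (det_frame u).

(* [movable j] does not involve the vector that the flow moves, and it singles out
   [j] in a way that is compatible with permutations. *)
Definition movable j u : Prop :=
  a + e < mdl (ldet phi u j w) /\ forall k, k != j -> mdl (f (u k)) < delta.

Definition move j u s : 'I_n -> X :=
  upd u j (slide m (dt u) (ldet phi u j w) w (u j) s).

(** The index is selected from [u] rather than fixed in advance, so that the flow commutes with
    permutations. Frames without a movable index stay put, a value that is irrelevant on
    [flow_dom]. *)
Definition flow u s : 'I_n -> X :=
  if [pick j | `[< movable j u >]] is Some j then move j u s else u.

Definition flow_dom u : Prop :=
  [/\ frames phi u, a - e < mdl (dt u) < a + e & exists j, movable j u].

(** If two distinct indices were movable, each would make [f] small on the vectors excluded by the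
    other. Then [f] would be small on all of [u], and [delta_small] would push the determinant down
    to [a - e]. *)
Lemma movable_uniq u j k : frames phi u -> a - e < mdl (dt u) ->
  movable j u -> movable k u -> j = k.
Proof.
move=> [u1 _] lo [_ mj] [_ mk]; apply: contrapT => /eqP jk.
suff : mdl (dt u) <= a - e by rewrite leNgt lo.
apply: delta_small => // i; have [->|] := eqVneq i j; first exact: mk.
exact: mj.
Qed.

Lemma flowE u s j : frames phi u -> a - e < mdl (dt u) -> movable j u ->
  flow u s = move j u s.
Proof.
move=> fu lo mj; rewrite /flow; case: pickP => [k /asboolP mk|/(_ j)].
  by rewrite (movable_uniq fu lo mk mj).
by move/asboolP.
Qed.

Lemma movable_upd j u x : movable j (upd u j x) <-> movable j u.
Proof.
rewrite /movable ldet_upd; split=> -[bl H]; split=> // k kj.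
  by have := H k kj; rewrite upd_other.
by rewrite upd_other//; exact: H.
Qed.

Lemma movable_slidable u j : frames phi u -> mdl (dt u) < a + e -> movable j u ->
  slidable m (a + e) (dt u) (ldet phi u j w) w (u j).
Proof.
move=> [u1 du] hi [bl _]; split => //.
by apply: (emb_inj (m := m)); rewrite nrmE u1 rmorph1.
Qed.

Let pos_level s : a - e < s < a + e -> 0 < s < a + e.
Proof. by move=> /andP[lo ->]; rewrite (lt_trans ae lo). Qed.

Lemma det_move u j s : frames phi u -> mdl (dt u) < a + e -> movable j u ->
  dt (move j u s) = dt u / emb (mdl (dt u)) * emb s.
Proof.
move=> fu hi mj; have sl := movable_slidable fu hi mj.
pose l : {linear X -> K^o} := ldet phi u j.
by apply: (slide_level sl (l := l)); first exact: ldet_self.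
Qed.

Lemma flow_spec u s : flow_dom u -> a - e < s < a + e ->
  flow_dom (flow u s) /\ mdl (dt (flow u s)) = s.
Proof.
move=> [fu /andP[lo hi] [j mj]] sI; rewrite (flowE _ fu lo mj).
have sl := movable_slidable fu hi mj.
have sP := pos_level sI; have /andP[s0 _] := sP.
have ds : mdl (dt (move j u s)) = s.
  rewrite (det_move _ fu hi mj); exact: (mdl_slide_level sl).
split => //; split; rewrite ?ds//; last by exists j; apply/movable_upd.
split; last by rewrite -(mdl_gt0 m) ds.
move=> i; rewrite /move /upd; case: eqP => [_|_]; last by case: fu.
by rewrite -(nrmE m) (nrm_slide sl sP) rmorph1.
Qed.

Lemma flow_id u : flow_dom u -> flow u (mdl (dt u)) = u.
Proof.
move=> [fu /andP[lo hi] [j mj]]; rewrite (flowE _ fu lo mj).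
by rewrite /move (slide_id (movable_slidable fu hi mj)) upd_id.
Qed.

Lemma flow_flow u s t : flow_dom u -> a - e < s < a + e -> a - e < t < a + e ->
  flow (flow u s) t = flow u t.
Proof.
move=> du sI tI; have [[fs /andP[los his] _] _] := flow_spec du sI.
have [fu /andP[lo hi] [j mj]] := du; have sl := movable_slidable fu hi mj.
move: fs los his; rewrite !(flowE _ fu lo mj) => fs los his.
rewrite (@flowE _ _ j fs los); last exact/movable_upd.
rewrite {1}/move (det_move _ fu hi mj) /move ldet_upd upd_same upd_upd.
by rewrite (slide_slide sl (pos_level sI) (pos_level tI)).
Qed.

Section Equivariance.
Variables (sg : 'S_n) (d : 'I_n -> K).
Hypothesis d1 : forall i, mdl (d i) = 1.

Lemma movable_monact j u : movable j (monact sg d u) <-> movable (sg j) u.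
Proof.
have E : mdl (ldet phi (monact sg d u) j w) = mdl (ldet phi u (sg j) w).
  rewrite (ldet_monact _ _ d1) -mulrA mdlM (mdl_moncoef _ d1) mul1r.
  by rewrite mdlM mdlV d1 invr1 mul1r.
have fE k : mdl (f (monact sg d u k)) = mdl (f (u (sg k))).
  by rewrite linearZ; apply: etrans (mdlM _ _ _) _; rewrite d1 mul1r.
rewrite /movable E; split=> -[bl H]; split=> // k.
  rewrite -[k](permKV sg) (inj_eq perm_inj) => kj.
  by have := H _ kj; rewrite fE.
by move=> kj; rewrite fE; apply: H; rewrite (inj_eq perm_inj).
Qed.

Lemma flow_dom_monact u : frames phi (monact sg d u) -> flow_dom u ->
  flow_dom (monact sg d u).
Proof.
move=> fm [fu uI [j mj]]; split => //.
  by rewrite det_monact mdlM (mdl_moncoef _ d1) mul1r.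
by exists (sg^-1%g j); apply/movable_monact; rewrite permKV.
Qed.

(** This is [slide_scale] with [k] the determinant of the monomial matrix and [d] the phase of the
    moved vector. *)
Lemma flow_monact u s : frames phi (monact sg d u) -> flow_dom u ->
  flow (monact sg d u) s = monact sg d (flow u s).
Proof.
move=> fm du; have [fu /andP[lo hi] [j mj]] := du.
have [_ /andP[lom _] _] := flow_dom_monact fm du.
rewrite (flowE _ fu lo mj) -[j](permKV sg).
rewrite (@flowE _ _ (sg^-1%g j) fm lom); last by apply/movable_monact; rewrite permKV.
rewrite /move (ldet_monact _ _ d1) det_monact slide_scale ?(mdl_moncoef _ d1)//.
by rewrite upd_monact.
Qed.

End Equivariance.

Definition flow_domain : set (frames phi) := [set u : frames phi | flow_dom (\val u)].

Definition frame_flow (u : frames phi) s : frames phi :=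
  if pselect (frames phi (flow (\val u) s)) is left h
  then @exist _ (fun u => u \in frames phi) _ (mem_set h) else u.

Lemma frameP (u : frames phi) : frames phi (\val u).
Proof. exact: set_mem (valP u). Qed.

Lemma val_frame_flow (u : frames phi) s : flow_domain u -> a - e < s < a + e ->
  \val (frame_flow u s) = flow (\val u) s.
Proof.
move=> du sI; rewrite /frame_flow; case: pselect => // -[].
by have [[]] := flow_spec du sI.
Qed.

Lemma cvg_val (u : frames phi) : (\val v : {ptws 'I_n -> X}) @[v --> u] --> \val u.
Proof. exact: (@val_set_type_continuous _ (frames phi) u). Qed.

Lemma absdet_continuous : continuous absdet.
Proof.
by move=> u; exact: cvg_mdl _ (cvg_det_rows m phi_bij _ (@cvg_val u)).
Qed.

Lemma near_movable (u : frames phi) j : movable j (\val u) ->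
  \forall v \near u, movable j (\val v).
Proof.
move=> [bl H]; apply: filterI.
  have /cvgr_gt : mdl (ldet phi (\val v) j w) @[v --> u] --> mdl (ldet phi (\val u) j w).
    have c : ldet phi (\val v) j w @[v --> u] --> ldet phi (\val u) j w.
      exact: (cvg_ldet m phi_bij (u := fun v : frames phi => \val v) (x := fun=> w)
        _ (@cvg_val u) (cvg_cst w)).
    exact: cvg_mdl _ c.
  by apply.
apply: (@filter_forall (frames phi) 'I_n
  (fun k (v : frames phi) => k != j -> mdl (f (\val v k)) < delta) (nbhs u)) => k.
have [->|kj] := eqVneq k j; first by apply: nearW => v /=.
have /cvgr_lt : mdl (f (\val v k)) @[v --> u] --> mdl (f (\val u k)).
  have c : (\val v k : X) @[v --> u] --> \val u k.
    exact: (@cvg_eval _ _ _ _ (fun v : frames phi => \val v) _ k _ (@cvg_val u)).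
  have cf : (f (\val v k) : K) @[v --> u] --> (f (\val u k) : K).
    by apply: (cvg_comp (fun v : frames phi => \val v k) f c); exact: f_cont.
  exact: cvg_mdl _ cf.
by move=> /(_ _ (H _ kj)); apply: filterS => v.
Qed.

Lemma open_flow_domain : open flow_domain.
Proof.
rewrite openE => u [fu /andP[lo hi] [j mj]]; rewrite /interior.
have nlo := cvgr_gt _ (absdet_continuous (x := u)) _ lo.
have nhi := cvgr_lt _ (absdet_continuous (x := u)) _ hi.
have nj := near_movable mj.
near=> v; split; first exact: frameP.
  by apply/andP; split; near: v; [exact: nlo|exact: nhi].
by exists j; near: v.
Unshelve. all: by end_near. Qed.

(** Being movable is an open condition, so near [u] the moved index is constantly [j] and the flow
    coincides with the continuous map [move j]. *)
Lemma frame_flow_continuous (u : frames phi) s : flow_domain u -> a - e < s < a + e ->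
  {for (u, s), continuous (fun p : frames phi * R => frame_flow p.1 p.2)}.
Proof.
move=> du sI; have [fu /andP[lo hi] [j mj]] := du.
apply: cvg_set_type => /=; rewrite val_frame_flow// (flowE _ fu lo mj).
have c1 : (\val p.1 : {ptws 'I_n -> X}) @[p --> (u, s)] --> \val u.
  by apply: (cvg_comp _ _ cvg_fst); exact: (@cvg_val u).
have c2 : (p.2 : R) @[p --> (u, s)] --> s by exact: cvg_snd.
have cm : (move j (\val p.1) p.2 : {ptws 'I_n -> X}) @[p --> (u, s)] -->
    (move j (\val u) s : {ptws 'I_n -> X}).
  apply: cvg_upd => //.
  apply: (cvg_slide (b := a + e)) => //; last exact: pos_level.
  - exact: (cvg_det_rows m phi_bij).
  - by apply: (cvg_ldet m phi_bij) => //; exact: cvg_cst.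
  - exact: (@cvg_eval _ _ _ _ (fun p : frames phi * R => \val p.1) _ j _ c1).
  - exact: movable_slidable.
apply: cvg_trans cm; apply: near_eq_cvg.
have n1 : \forall p \near (u, s), flow_domain p.1.
  by apply: (@cvg_fst _ _ (nbhs u) (nbhs s)); apply: open_nbhs_nbhs;
    split => //; exact: open_flow_domain.
have n2 : \forall p \near (u, s), a - e < p.2 < a + e.
  have ns : nbhs s [set t | a - e < t < a + e].
    have : s \in `](a - e), (a + e)[ by rewrite in_itv.
    by move=> /near_in_itvoo; apply: filterS => t; rewrite /= in_itv.
  by exists (setT, [set t | a - e < t < a + e]) => [|p []]//; split => //; exact: filterT.
have n3 : \forall p \near (u, s), movable j (\val p.1).
  apply: (@cvg_fst _ _ (nbhs u) (nbhs s) _ [set v : frames phi | movable j (\val v)]).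
  exact: near_movable.
near=> p.
have dp : flow_domain p.1 by near: p.
have pI : a - e < p.2 < a + e by near: p.
rewrite val_frame_flow//; have [fp /andP[lop _] _] := dp.
by rewrite (@flowE _ _ j fp lop)//; near: p.
Unshelve. all: by end_near. Qed.

Lemma frame_flowP (u : frames phi) s : flow_domain u -> a - e < s < a + e ->
  flow_domain (frame_flow u s) /\ absdet (frame_flow u s) = s.
Proof.
move=> du sI; have fE := val_frame_flow du sI.
have [ds gs] := flow_spec du sI.
by split; [rewrite /flow_domain /mkset fE|rewrite /absdet /det_frame fE].
Qed.

Lemma flow_domain_level (u : frames phi) : flow_domain u -> a - e < absdet u < a + e.
Proof. by case. Qed.

Lemma frame_flow_id (u : frames phi) : flow_domain u -> frame_flow u (absdet u) = u.
Proof.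
move=> du; apply: val_inj; rewrite val_frame_flow ?flow_domain_level//.
exact: flow_id.
Qed.

Lemma frame_flow_flow (u : frames phi) s t : flow_domain u -> a - e < s < a + e ->
  a - e < t < a + e -> frame_flow (frame_flow u s) t = frame_flow u t.
Proof.
move=> du sI tI; have [ds _] := frame_flowP du sI.
by apply: val_inj; rewrite !val_frame_flow//; exact: flow_flow.
Qed.

Lemma regular_frame (u : frames phi) : flow_domain u -> topologically_regular absdet u.
Proof.
apply: (regular_of_flow e0 absdet_continuous open_flow_domain flow_domain_level
  frame_flowP frame_flow_id frame_flow_flow frame_flow_continuous).
Qed.

Section Quotient.
Variable G : set 'M[K]_n.
Hypothesis G_group : is_matrix_group G.
Hypothesis G_monomial : forall g, G g -> monomial g.

(** The last clause records that the same [sg] and [d] keep every other frame in its orbit, so they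
    can be applied to a whole neighbourhood or to flowed frames. *)
Lemma equivalent_monact (u v : 'I_n -> X) : equivalent G u v ->
  exists (sg : 'S_n) (d : 'I_n -> K), [/\ forall i, mdl (d i) = 1, v = monact sg d u &
    forall u', equivalent G u' (monact sg d u')].
Proof.
case=> g Gg vE; have [sg [d [d1 gE]]] := G_monomial Gg.
have gu u' i : \sum_(j < n) g i j *: u' j = monact sg d u' i.
  rewrite (bigD1 (sg i))//= big1 ?addr0 ?gE ?eqxx// => j ji.
  by rewrite gE eq_sym (negbTE ji) scale0r.
exists sg, d; split.
- by move=> i; apply: (emb_inj (m := m)); rewrite mdlE d1 rmorph1.
- by apply/funext => i; rewrite vE gu.
- by move=> u'; exists g => // i; rewrite gu.
Qed.

Lemma frames_monact (sg : 'S_n) (d : 'I_n -> K) u :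
  (forall i, mdl (d i) = 1) -> frames phi u -> frames phi (monact sg d u).
Proof.
move=> d1 [u1 du]; split=> [i|].
  by rewrite normrZ u1 mulr1 -(mdlE m) d1 rmorph1.
by rewrite -(mdl_gt0 m) det_monact mdlM (mdl_moncoef _ d1) mul1r mdl_gt0.
Qed.

Lemma monact_continuous (sg : 'S_n) (d : 'I_n -> K) :
  continuous (monact sg d : {ptws 'I_n -> X} -> {ptws 'I_n -> X}).
Proof.
move=> u.
have ci i : d i *: (u' : {ptws 'I_n -> X}) (sg i) @[u' --> u] --> d i *: u (sg i).
  have c1 : (u' : {ptws 'I_n -> X}) (sg i) @[u' --> u] --> u (sg i).
    exact: (@proj_continuous 'I_n (fun=> X) (sg i) u).
  have FF : Filter (nbhs u) by exact: nbhs_filter.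
  have c2 : (fun _ : {ptws 'I_n -> X} => d i) @ nbhs u --> nbhs (d i).
    exact: (@cvg_cst _ _ _ (nbhs u) FF).
  exact: cvgZ c2 c1.
exact: (@cvg_ptws 'I_n X _ (nbhs u) (monact sg d) (monact sg d u) _ ci).
Qed.

Local Notation pi := (\pi_(frames_quotient phi G_group)%qT).

Lemma pi_eqP (u v : frames phi) : pi u = pi v <-> equivalent G (\val u) (\val v).
Proof. by split=> [/eqquotP/asboolP|H] //; apply/eqquotP/asboolP. Qed.

(** The group acts by continuous maps: the element [h] carrying [v] to [u] pulls [A] back to a
    neighbourhood of [v] inside the saturation. *)
Lemma pi_open (A : set (frames phi)) : open A ->
  open [set v | exists2 u, A u & pi u = pi v].
Proof.
move=> oA; rewrite openE => v [u Au /esym /pi_eqP uv]; rewrite /interior.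
have [sg [d [d1 uE eqG]]] := equivalent_monact uv.
pose h (x : frames phi) : frames phi := @exist {ptws 'I_n -> X}
  (fun y => y \in frames phi) _ (mem_set (frames_monact sg d1 (frameP x))).
have hE (x : frames phi) : pi (h x) = pi x by apply/esym/pi_eqP; exact: eqG.
have hu : h v = u by apply: val_inj; rewrite /= uE.
have ch : continuous h.
  move=> x; apply: (@cvg_set_type _ (frames phi) _ (nbhs x) h (h x)).
  exact: (cvg_comp (fun y : frames phi => (\val y : {ptws 'I_n -> X}))
    (monact sg d : {ptws 'I_n -> X} -> {ptws 'I_n -> X})
    (@cvg_val x) (@monact_continuous sg d (\val x))).
have : nbhs v (h @^-1` A).
  by apply: ch; rewrite hu; exact: open_nbhs_nbhs.
by apply: filterS => x Ax; exists (h x).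
Qed.

Lemma regular_orbit (u : frames phi) : flow_domain u ->
  topologically_regular (induced_map G_group absdet) (pi u).
Proof.
apply: (regular_of_equivariant_flow pi_open _ _ _ e0 absdet_continuous
  open_flow_domain flow_domain_level
  frame_flowP frame_flow_id frame_flow_flow frame_flow_continuous).
- move=> x y /pi_eqP /equivalent_monact [sg [d [d1 yE _]]].
  by rewrite /absdet /det_frame yE det_monact mdlM (mdl_moncoef _ d1) mul1r.
- move=> x y /pi_eqP /equivalent_monact [sg [d [d1 yE _]]] dx.
  rewrite /flow_domain/= yE; apply: flow_dom_monact => //.
  by rewrite -yE; exact: frameP.
- move=> x y s xy dx sI.
  have /pi_eqP /equivalent_monact [sg [d [d1 yE eqG]]] := xy.
  have fm : frames phi (monact sg d (\val x)) by rewrite -yE; exact: frameP.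
  have dy : flow_domain y by rewrite /flow_domain/= yE; exact: flow_dom_monact.
  by apply/pi_eqP; rewrite !val_frame_flow// yE flow_monact.
Qed.

End Quotient.
End Flow.

(** * Regularity at frames that are not Auerbach bases *)

(** Each of the [n!] products in the Leibniz formula has exactly one factor from column [i0]. *)
Lemma norm_det_le (K : numDomainType) n (B : 'M[K]_n) (M delta : K) (i0 : 'I_n) :
  (forall k l, `|B k l| <= M) -> (forall k, `|B k i0| <= delta) ->
  `|\det B| <= n`!%:R * M ^+ n.-1 * delta.
Proof.
move=> BM Bd; apply: le_trans (ler_norm_sum _ _ _) _.
have -> : n`!%:R * M ^+ n.-1 * delta = \sum_(s : 'S_n) M ^+ n.-1 * delta.
  by rewrite sumr_const card_Sn -mulrA mulr_natl.
apply: ler_sum => s _; rewrite normrM normr_sign mul1r normr_prod.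
rewrite (bigD1 ((s^-1)%g i0))//= permKV mulrC.
have -> : M ^+ n.-1 = \prod_(k | k != (s^-1)%g i0) M.
  rewrite (eq_bigl (mem (predC1 ((s^-1)%g i0)))) ?prodr_const ?cardC1 ?card_ord//.
apply: ler_pM => //; first by apply: prodr_ge0.
by apply: ler_prod => k _; rewrite normr_ge0 BM.
Qed.

Section Regularity.
Variables (R : realType) (K : numFieldType) (m : real_scalars R K).
Variables (X : normedModType K) (n : nat) (phi : {linear X -> 'rV[K]_n}).
Hypothesis phi_bij : bijective phi.
Variable G : set 'M[K]_n.
Hypothesis G_group : is_matrix_group G.
Hypothesis G_monomial : forall g, G g -> monomial g.
Local Notation mdl := (mdl m).
Local Notation emb := (emb m).
Local Notation nrm := (nrm m).
Local Notation dt u := (\det (rows phi u)).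

(** Take for [f] the coordinate along [v i0] in the basis [v]. The determinant of [u] is that of [v]
    times the determinant of the coordinates of [u] in this basis, and the latter is small when its
    column [i0] is. *)
Lemma dual_coordinate (v : 'I_n -> X) (i0 : 'I_n) : dt v != 0 ->
  exists f : {linear X -> K^o}, exists delta : R,
    [/\ continuous f, 0 < delta, forall k, k != i0 -> f (v k) = 0 &
      forall u, (forall i, `|u i| = 1) -> (forall i, mdl (f (u i)) < delta) ->
        mdl (dt u) <= mdl (dt v) / 2].
Proof.
move=> dv; have vU : rows phi v \in unitmx by rewrite unitmxE unitfE.
pose psi : {linear X -> 'rV[K]_n} := mulmxr (invmx (rows phi v)) \o phi.
have psiE x : psi x = phi x *m invmx (rows phi v) by [].
have psi_bij : bijective psi.
  have [inv phiK invK] := phi_bij.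
  exists (fun a => inv (a *m rows phi v)) => x; rewrite psiE ?invK ?mulmxK//.
  by rewrite mulmxKV// phiK.
have [C C0 psiC] := coord_bounded m psi_bij.
have flin : linear (fun x => psi x 0 i0 : K^o).
  by move=> c x y; rewrite linearP !mxE.
pose fL := GRing.isLinear.Build K X K^o *:%R (fun x => psi x 0 i0 : K^o) flin.
pose f : {linear X -> K^o} := HB.pack (fun x => psi x 0 i0 : K^o) fL.
have fE x : f x = psi x 0 i0 by [].
pose N : R := n`!%:R * C ^+ n.-1.
have N0 : 0 <= N by rewrite mulr_ge0// exprn_ge0.
have N1 : 0 < 2 * (N + 1) by rewrite mulr_gt0// ltr_wpDl.
have rows_psi u : rows psi u = rows phi u *m invmx (rows phi v).
  by apply/row_matrixP => i; rewrite row_mul !rowK.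
(* This value makes [N * delta] at most [1 / 2]; the added [1] keeps the denominator positive when
   [N] vanishes. *)
exists f, (2 * (N + 1))^-1; split.
- exact: (coord_continuous m psi_bij).
- by rewrite invr_gt0.
- move=> k ki; rewrite fE.
  have : (rows phi v *m invmx (rows phi v)) k i0 = 0.
    by rewrite mulmxV// mxE (negbTE ki).
  by rewrite -rows_psi mxE.
- move=> u u1 fu.
  have -> : dt u = dt v * \det (rows psi u).
    by rewrite rows_psi det_mulmx mulrCA -det_mulmx mulmxV// det1 mulr1.
  rewrite mdlM ler_wpM2l ?mdl_ge0//.
  have : `|\det (rows psi u)| <= n`!%:R * (emb C) ^+ n.-1 * emb (2 * (N + 1))^-1.
    apply: (@norm_det_le _ _ _ _ _ i0) => k => [l|]; rewrite mxE -(mdlE m) emb_le.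
      apply: le_trans (psiC _ _) _.
      have -> : nrm (u k) = 1 by apply: (emb_inj (m := m)); rewrite nrmE u1 rmorph1.
      by rewrite mulr1.
    exact: ltW (fu k).
  rewrite -(mdlE m) -(rmorph_nat emb) -rmorphXn -!rmorphM emb_le -/N.
  move=> /le_trans; apply; rewrite ler_pdivrMr// mulrA mulVf ?pnatr_eq0// mul1r.
  by rewrite lerDl.
Qed.

Lemma regular_of_not_auerbach (v : frames phi) : ~ auerbach (\val v) ->
  topologically_regular (absdet m (phi := phi)) v /\
  topologically_regular (induced_map G_group (absdet m (phi := phi)))
    (\pi_(frames_quotient phi G_group)%qT v).
Proof.
move=> nA; have [v1 dv] := frameP v.
have [i0 [w [w1 wlt]]] := not_auerbach_ldet m phi_bij v1 dv nA.
have [f [delta [f_cont delta0 fv fsmall]]] := dual_coordinate i0 dv.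
set a := mdl (dt (\val v)) in wlt fsmall.
have a0 : 0 < a by rewrite mdl_gt0.
(* The first bound keeps [a - e] above [a / 2], the threshold provided by [fsmall]; the second keeps
   [a + e] below the level reached with [w]. *)
pose e := Num.min (a / 2) ((mdl (ldet phi (\val v) i0 w) - a) / 2).
have e0 : 0 < e by rewrite lt_min !divr_gt0 ?subr_gt0.
have ea : e <= a / 2 by rewrite ge_min lexx.
have ae : a / 2 <= a - e by lra.
have aew : a + e < mdl (ldet phi (\val v) i0 w).
  have : e <= (mdl (ldet phi (\val v) i0 w) - a) / 2 by rewrite ge_min lexx orbT.
  by lra.
have ae0 : 0 < a - e by apply: lt_le_trans ae; rewrite divr_gt0.
have dsmall u : (forall i, `|u i| = 1) -> (forall i, mdl (f (u i)) < delta) ->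
    mdl (dt u) <= a - e.
  by move=> u1 fu; apply: le_trans ae; exact: fsmall.
have dom : flow_domain m w f delta a e v.
  split; first exact: frameP.
    by rewrite -/a ltrDl e0 ltrBlDr ltrDl e0.
  by exists i0; split => // k /fv ->; rewrite mdl0.
split; first exact: (regular_frame phi_bij w1 f_cont e0 ae0 dsmall dom).
exact: (regular_orbit phi_bij w1 f_cont e0 ae0 dsmall G_group G_monomial dom).
Qed.

Lemma bifurcation_auerbach :
  [/\ forall v : frames phi,
        bifurcation_point (absdet m (phi := phi)) v -> auerbach (\val v),
      forall q : frames_quotient phi G_group,
        bifurcation_point (induced_map G_group (absdet m (phi := phi))) q ->
        auerbach_class phi G (orbit_of G_group q) &
      forall q1 q2 : frames_quotient phi G_group,
        q1 <> q2 -> orbit_of G_group q1 <> orbit_of G_group q2].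
Proof.
split.
- move=> v bv; apply: contrapT => nA; apply: bv.
  by have [] := regular_of_not_auerbach nA.
- move=> q bq.
  (* Any representative that is not Auerbach would make [q] regular, so the whole orbit consists of
     Auerbach bases. *)
  have A v : orbit_of G_group q v -> auerbach (\val v).
    move=> vq; apply: contrapT => nA; apply: bq; rewrite -vq.
    by have [] := regular_of_not_auerbach nA.
  have rq : orbit_of G_group q (repr q) by exact: reprK.
  exists (repr q); first exact: A.
  apply/seteqP; split=> v /=.
    move=> vq; split; first exact: A.
    by apply/(pi_eqP G_group); rewrite vq.
  by move=> [_ /(pi_eqP G_group) E]; apply: etrans (esym E) rq.
- move=> q1 q2 ne E; apply: ne.
  have : orbit_of G_group q1 (repr q1) by exact: reprK.
  by rewrite E => <-; exact/esym/reprK.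
Qed.

End Regularity.

(** * The groups [Bn] and [NTn] consist of monomial matrices *)

Section MonomialGroup.
Variables (K : numFieldType) (n : nat).

Lemma monomialM (g h : 'M[K]_n) : monomial g -> monomial h -> monomial (g *m h).
Proof.
move=> [s [d [d1 gE]]] [t [c [c1 hE]]].
exists (s * t)%g, (fun i => d i * c (s i)); split.
  by move=> i; rewrite normrM d1 c1 mulr1.
move=> i j; rewrite mxE (bigD1 (s i))//= big1 ?addr0.
  by rewrite gE eqxx hE permM; case: eqP => // _; rewrite mulr0.
by move=> k ki; rewrite gE eq_sym (negbTE ki) mul0r.
Qed.

Lemma monomial1 : monomial (1%:M : 'M[K]_n).
Proof.
exists 1%g, (fun=> 1); split=> [i|i j]; first by rewrite normr1.
by rewrite perm1 mxE; case: eqP.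
Qed.

(** For square matrices a right inverse is the inverse, so this yields both invertibility and
    closure under inversion. *)
Lemma monomial_rinv (g : 'M[K]_n) : monomial g ->
  exists2 h, monomial h & g *m h = 1%:M.
Proof.
move=> [s [d [d1 gE]]].
have d0 i : d i != 0 by rewrite -normr_eq0 d1 oner_eq0.
pose h : 'M[K]_n := \matrix_(i, j) if (s^-1)%g i == j then (d ((s^-1)%g i))^-1 else 0.
exists h.
  exists (s^-1)%g, (fun i => (d ((s^-1)%g i))^-1); split=> [i|i j].
    by rewrite normfV d1 invr1.
  by rewrite mxE.
apply/matrixP => i j; rewrite mxE (bigD1 (s i))//= big1 ?addr0.
  by rewrite gE eqxx !mxE permK; case: eqP; rewrite ?mulr0 ?divff.
by move=> k ki; rewrite gE eq_sym (negbTE ki) mul0r.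
Qed.

Lemma monomial_unit (g : 'M[K]_n) : monomial g -> g \in unitmx.
Proof. by move=> /monomial_rinv[h _ /mulmx1_unit[]]. Qed.

Lemma monomial_group : is_matrix_group (@monomial K n).
Proof.
split; [exact: monomial_unit|exact: monomial1|exact: monomialM|].
move=> g mg; have [h mh gh] := monomial_rinv mg.
by rewrite -[invmx g]mulmx1 -gh mulKmx ?monomial_unit.
Qed.

End MonomialGroup.

(** The monomial matrices form a group containing the generators, and [Bn] is the smallest such
    group. *)
Lemma Bn_monomial (R : realType) n (g : 'M[R]_n) : Bn n R g -> monomial g.
Proof.
apply; split; first exact: monomial_group.
move=> _ [[s _ <-]|[d /= dP <-]].
  exists s, (fun=> 1); split=> [i|i j]; first by rewrite normr1.
  by rewrite !mxE; case: eqP.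
exists 1%g, (fun i => d 0 i); split=> [i|i j].
  by case: (dP i) => ->; rewrite ?normrN normr1.
by rewrite perm1 mxE; case: eqP => // ->; rewrite mulr1n.
Qed.

(* Conjugating by [g] the diagonal matrix that is [-1] at [j] and [1] elsewhere has to
   give a diagonal matrix, so a row of [g] that is nonzero at [j] vanishes elsewhere. *)
Lemma NTn_row (R : realType) n (g : 'M[R[i]]_n) (i j k : 'I_n) : NTn n R g ->
  g i j != 0 -> g i k != 0 -> j = k.
Proof.
move=> [Ug Ng] gij gik; apply: contrapT => /eqP jk.
pose t : 'rV[R[i]]_n := \row_l (if l == j then -1 else 1).
have Tt : Tn n R (diag_mx t).
  by exists t => // l /=; rewrite mxE; case: ifP; rewrite ?normrN normr1.
have : [set g *m t *m invmx g | t in Tn n R] (g *m diag_mx t *m invmx g).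
  by exists (diag_mx t).
rewrite Ng => -[t' _ /= t'E].
have E : g *m diag_mx t = diag_mx t' *m g.
  by rewrite t'E mulmxKV ?unitarymx_unit.
have := congr1 (fun A : 'M[R[i]]_n => A i j) E; have := congr1 (fun A : 'M[R[i]]_n => A i k) E.
rewrite mul_mx_diag mul_diag_mx !mxE eqxx eq_sym (negbTE jk) [RHS]mulrC.
move=> /(mulfI gik) <-; rewrite mul1r mulrN1 => /eqP.
by rewrite eq_sym -subr_eq0 opprK -mulr2n mulrn_eq0/= (negbTE gij).
Qed.

(** By [NTn_row] a row has at most one nonzero entry. Unit length of the rows gives that entry and
    its modulus, and orthogonality puts the entries of different rows in different columns. *)
Lemma NTn_monomial (R : realType) n (g : 'M[R[i]]_n) : NTn n R g -> monomial g.
Proof.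
move=> Ng; have [Ug _] := Ng.
have gg i k : \sum_j g i j * Num.conj (g k j) = (i == k)%:R.
  have /unitarymxP /matrixP /(_ i k) := Ug; rewrite !mxE => <-.
  by apply: eq_bigr => j _; rewrite !mxE.
have nz i : exists j, g i j != 0.
  apply: contrapT => H; have := gg i i; rewrite eqxx big1.
    by move/eqP; rewrite eq_sym oner_eq0.
  move=> j _; have [->|gij] := eqVneq (g i j) 0; first by rewrite mul0r.
  by case: H; exists j.
pose s i := xchoose (nz i); have sP i : g i (s i) != 0 by exact: xchooseP (nz i).
have g0 i j : j != s i -> g i j = 0.
  move=> js; apply/eqP; apply: contraNT js => gij.
  by apply/eqP; exact: NTn_row Ng gij (sP i).
have gsE i k : g i (s i) * Num.conj (g k (s i)) = (i == k)%:R.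
  by rewrite -gg (bigD1 (s i))//= big1 ?addr0// => j /g0 ->; rewrite mul0r.
have s_inj : injective s.
  move=> i k ik; apply: contrapT => /eqP nik; have := gsE i k.
  rewrite (negbTE nik) => /eqP; rewrite mulf_eq0 (negbTE (sP i))/= conjC_eq0 ik.
  by rewrite (negbTE (sP k)).
exists (perm s_inj), (fun i => g i (s i)); split=> [i|i j].
  by have /eqP := gsE i i; rewrite eqxx -normCK pexpr_eq1// => /eqP.
by rewrite permE; case: eqP => [->//|/eqP ij]; rewrite g0// eq_sym.
Qed.

(** * The real and the complex scalars *)

Lemma real_ball_compact (R : realType) : compact [set x : R | `|x| <= 1].
Proof.
rewrite (_ : [set x : R | _] = `[-1, 1]%classic); first exact: segment_compact.
by apply/seteqP; split=> x /=; rewrite in_itv /= ler_norml.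
Qed.

Definition real_scalars_R (R : realType) : real_scalars R R :=
  @RealScalars R R idfun (fun x => `|x|) (fun=> erefl) (fun _ _ => erefl)
    (@real_ball_compact R).

Lemma modulusE (R : realType) (z : R[i]) : (modulus z)%:C = `|z|.
Proof. by rewrite /modulus; case: z => a b; rewrite normc_def. Qed.

Lemma real_complex_continuous (R : realType) :
  continuous (real_complex R : R -> (R[i] : numFieldType)).
Proof.
move=> x; apply/cvgrPdist_lt => e e0.
have eE : e = (modulus e)%:C by rewrite modulusE gtr0_norm.
have m0 : 0 < modulus e by rewrite -ltcR -eE; exact: e0.
have /cvgrPdist_lt/(_ _ m0) := @cvg_id _ (nbhs x).
apply: filterS => y xy; rewrite -rmorphB eE/=.
rewrite normc_def/= expr0n/= addr0 sqrtr_sqr; by rewrite ltcR.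
Qed.

(** The ball is the continuous image of the closed unit disc of the real plane, which is a closed
    subset of the compact square with sides [[-1, 1]]. *)
Lemma complex_ball_compact (R : realType) :
  compact [set z : (R[i] : numFieldType) | `|z| <= 1].
Proof.
pose K : numFieldType := R[i].
pose f (p : R * R) : K := p.1%:C + 'i%C * p.2%:C.
pose q (p : R * R) : R := p.1 ^+ 2 + p.2 ^+ 2.
have cf : continuous f.
  move=> p.
  have c1 : (real_complex R r.1 : K) @[r --> p] --> (real_complex R p.1 : K).
    apply: (cvg_comp (@fst R R) (real_complex R : R -> K)); first exact: cvg_fst.
    exact: real_complex_continuous.
  have c2 : (real_complex R r.2 : K) @[r --> p] --> (real_complex R p.2 : K).
    apply: (cvg_comp (@snd R R) (real_complex R : R -> K)); first exact: cvg_snd.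
    exact: real_complex_continuous.
  exact: cvgD c1 (cvgM (cvg_cst _) c2).
have cq : continuous q.
  move=> p; apply: cvgD; rewrite expr2; under eq_fun do rewrite expr2.
    by apply: cvgM; exact: cvg_fst.
  by apply: cvgM; exact: cvg_snd.
pose D : set (R * R) := [set p | q p <= 1].
have cD : compact D.
  apply: (subclosed_compact _ (compact_setX (@segment_compact R (-1) 1)
    (@segment_compact R (-1) 1))).
    rewrite (_ : D = q @^-1` [set y | y <= 1])//.
    by apply: closed_comp => [p _|]; [exact: cq|exact: closed_le].
  move=> [a b]; rewrite /D /q /= => ab.
  by split; rewrite /= in_itv/= -ler_norml -(@ler_pXn2r _ 2)// ?nnegrE// expr1n
    real_normK ?num_real//; apply: le_trans ab; rewrite ?lerDl ?lerDr sqr_ge0.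
rewrite (_ : [set z | _] = f @` D); last first.
  have fE (a b : R) : `|f (a, b)| = (Num.sqrt (a ^+ 2 + b ^+ 2))%:C.
    by rewrite normc_def /f /= !mul0r !mul1r !subr0 !addr0 !add0r.
  have fD (a b : R) : (`|f (a, b)| <= 1) = (q (a, b) <= 1).
    by rewrite fE -[1]/(1%:C) lecR -{1}(sqrtr1 R) ler_sqrt.
  apply/seteqP; split=> [[a b] /= z1|_ [[a b] /= Dab <-]]; last by rewrite fD.
  have zE : f (a, b) = a +i* b.
    by apply/eqP; rewrite eq_complex /f /= !mul0r !mul1r !subr0 !addr0 !add0r !eqxx.
  by exists (a, b) => //; rewrite /D /= -fD zE.
by apply: continuous_compact => //; apply: continuous_subspaceT.
Qed.

Definition real_scalars_C (R : realType) : real_scalars R R[i] :=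
  @RealScalars R R[i] (real_complex R) (@modulus R) (@modulusE R)
    (@lecR R) (@complex_ball_compact R).

Theorem corollary6p4 (R : realType) (n : nat) :
  (forall (X : completeNormedModType R) (phi : {linear X -> 'rV[R]_n}),
    bijective phi ->
    [/\ forall v : frames phi,
          bifurcation_point (absdetR phi) v -> auerbach (\val v),
        forall q : frames_quotient phi (Bn_group n R),
          bifurcation_point (induced_map (Bn_group n R) (absdetR phi)) q ->
          auerbach_class phi (Bn n R) (orbit_of (Bn_group n R) q) &
        forall q1 q2 : frames_quotient phi (Bn_group n R),
          bifurcation_point (induced_map (Bn_group n R) (absdetR phi)) q1 ->
          bifurcation_point (induced_map (Bn_group n R) (absdetR phi)) q2 ->
          q1 <> q2 ->
          orbit_of (Bn_group n R) q1 <> orbit_of (Bn_group n R) q2])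
  /\
  (forall (X : completeNormedModType R[i]) (phi : {linear X -> 'rV[R[i]]_n}),
    bijective phi ->
    [/\ forall v : frames phi,
          bifurcation_point (absdetC phi) v -> auerbach (\val v),
        forall q : frames_quotient phi (NTn_group n R),
          bifurcation_point (induced_map (NTn_group n R) (absdetC phi)) q ->
          auerbach_class phi (NTn n R) (orbit_of (NTn_group n R) q) &
        forall q1 q2 : frames_quotient phi (NTn_group n R),
          bifurcation_point (induced_map (NTn_group n R) (absdetC phi)) q1 ->
          bifurcation_point (induced_map (NTn_group n R) (absdetC phi)) q2 ->
          q1 <> q2 ->
          orbit_of (NTn_group n R) q1 <> orbit_of (NTn_group n R) q2]).
Proof.
split=> X phi phi_bij.
  (* For these scalars [absdet] is convertible to [absdetR], and in the complex case below to
     [absdetC]. *)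
  have [A B C] := bifurcation_auerbach (real_scalars_R R) phi_bij (Bn_group n R)
    (@Bn_monomial R n).
  by split=> // q1 q2 _ _; exact: C.
have [A B C] := bifurcation_auerbach (real_scalars_C R) phi_bij (NTn_group n R)
  (@NTn_monomial R n).
by split=> // q1 q2 _ _; exact: C.
Qed.
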